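(* Let $G=\mathrm{SL}(3,\mathbb{C})$ act on $G\times G$ by simultaneous conjugation, and let $G^{\times 2}/\!\!/G$ be the categorical quotient. Then $G^{\times 2}/\!\!/G$ is isomorphic to an affine hypersurface of degree $6$ in $\mathbb{C}^9$, which maps onto $\mathbb{C}^8$.
   Context: The categorical quotient $G^{\times 2}/\!\!/G=\mathrm{Spec}_{max}(\mathbb{C}[G\times G]^{G})$ is the affine variety whose coordinate ring is the ring of polynomial functions on $G\times G$ invariant under $g\cdot(A,B)=(gAg^{-1},gBg^{-1})$. It is also called the $\mathrm{SL}(3,\mathbb{C})$-character variety of the free group of rank $2$. A hypersurface of degree $6$ in $\mathbb{C}^9$ means the zero set of a polynomial of total degree $6$ in nine variables, with coordinate ring the polynomial ring modulo that polynomial. *)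

(* Defs.v *)
From HB Require Import structures.
From mathcomp Require Import all_boot all_order all_algebra.
From mathcomp Require Import ring_quotient complex.
From mathcomp Require Import mpoly.
From mathcomp Require Import boolp classical_sets functions reals.

Set Implicit Arguments.
Unset Strict Implicit.
Unset Printing Implicit Defensive.

Import GRing.Theory.

Local Open Scope classical_set_scope.
Local Open Scope quotient_scope.
Local Open Scope ring_scope.

(* [vanish x] is the set of the functions of the coordinate ring that vanish *)
(* at the point [x].  Over an algebraically closed field it determines the   *)
(* value of a function [a] at [x], as the unique c such that [a - c%:A]      *)
(* vanishes at [x].                                                          *)
Record affine_variety (K : fieldType) := AffineVariety {
  coord : comAlgType K;
  point : Type;
  vanish : point -> set coord
}.

(* [phi] is the comorphism of [F]: the last condition says that [phi b] is   *)
(* the pull-back of [b] along [F].                                           *)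
Definition isomorphic (K : fieldType) (X Y : affine_variety K) : Prop :=
  exists (F : point X -> point Y) (phi : {lrmorphism coord Y -> coord X}),
    [/\ bijective F, bijective phi &
        forall (x : point X) (b : coord Y),
          vanish x (phi b) <-> vanish (F x) b].

Section MaximalSpectrum.
Variables (K : fieldType) (A : comAlgType K).

Definition is_ideal (I : set A) : Prop :=
  [/\ I 0, (forall a b, I a -> I b -> I (a + b)) &
      (forall a b, I b -> I (a * b))].

Definition is_maximal_ideal (m : set A) : Prop :=
  [/\ is_ideal m, ~ m 1 &
      forall I : set A, is_ideal I -> ~ I 1 -> m `<=` I -> I = m].

Definition max_ideals : set (set A) := [set m | is_maximal_ideal m].

Definition Spec_max : affine_variety K :=
  @AffineVariety K A max_ideals (fun m => set_val m).

End MaximalSpectrum.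

Record nonconst_mpoly (K : fieldType) (n : nat) := NonconstMpoly {
  mpoly_of_nonconst :> {mpoly K[n]};
  nonconst_msize : (1 < msize mpoly_of_nonconst)%N
}.

(* [msize] is one more than the total degree. *)
Definition total_degree (K : fieldType) (n : nat) (f : {mpoly K[n]}) : nat :=
  (msize f).-1.

Section Hypersurface.
Variables (K : fieldType) (n : nat) (f : nonconst_mpoly K n).

Definition principal : {pred {mpoly K[n]}} :=
  fun p => `[< exists q, p = q * (f : {mpoly K[n]}) >].

Lemma principal_idealr_closed : idealr_closed principal.
Proof.
split.
- by apply/asboolP; exists 0; rewrite mul0r.
- apply/asboolP => -[q qf]; have f1 := nonconst_msize f.
  have f0 : (f : {mpoly K[n]}) != 0.
    by apply/eqP => f0; move: f1; rewrite f0 mmeasure0.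
  have q0 : q != 0.
    by apply/eqP => q0; move/eqP: qf; rewrite q0 mul0r oner_eq0.
  have := congr1 (fun p : {mpoly K[n]} => msize p) qf.
  rewrite /= msizeM // msize1.
  have : (0 < msize q)%N by rewrite lt0n msize_poly_eq0.
  move: f1; case: (msize q) => // a; case: (msize _) => [|[|b]] // _ _.
  by rewrite addSn !addnS.
- move=> a p r /asboolP[u ->] /asboolP[v ->]; apply/asboolP.
  by exists (a * u + v); rewrite mulrDl mulrA.
Qed.

HB.instance Definition _ :=
  isIdealr.Build {mpoly K[n]} principal principal_idealr_closed.

Definition hypersurface_ring := {ideal_quot principal}.

HB.instance Definition _ := GRing.ComNzRing.on hypersurface_ring.

Definition hs_scale (a : K) (u : hypersurface_ring) : hypersurface_ring :=
  \pi_{ideal_quot principal} (a%:MP) * u.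

Let hs_scalerA a b u : hs_scale a (hs_scale b u) = hs_scale (a * b) u.
Proof. by rewrite /hs_scale mulrA mpolyCM rmorphM. Qed.

Let hs_scale1r : left_id 1 hs_scale.
Proof. by move=> u; rewrite /hs_scale mpolyC1 rmorph1 mul1r. Qed.

Let hs_scalerDr : right_distributive hs_scale +%R.
Proof. by move=> a u v; rewrite /hs_scale mulrDr. Qed.

Let hs_scalerDl u : {morph hs_scale^~ u : a b / a + b}.
Proof. by move=> a b; rewrite /hs_scale mpolyCD rmorphD mulrDl. Qed.

HB.instance Definition _ := GRing.Zmodule_isLmodule.Build K hypersurface_ring
  hs_scalerA hs_scale1r hs_scalerDr hs_scalerDl.

Let hs_scalerAl a (u v : hypersurface_ring) : a *: (u * v) = (a *: u) * v.
Proof. exact: mulrA. Qed.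

HB.instance Definition _ :=
  GRing.Lmodule_isLalgebra.Build K hypersurface_ring hs_scalerAl.
HB.instance Definition _ :=
  GRing.Lalgebra_isComAlgebra.Build K hypersurface_ring.

Definition zeros : set 'rV[K]_n := [set x | f.@[x 0] = 0].

(* Independent of the representative, see [hs_evalE]. *)
Definition hs_eval (x : zeros) (u : hypersurface_ring) : K :=
  (repr u).@[set_val x 0].

Lemma hs_evalE (x : zeros) (p : {mpoly K[n]}) :
  hs_eval x (\pi_{ideal_quot principal} p) = p.@[set_val x 0].
Proof.
rewrite /hs_eval; set r := repr _.
have : r - p \in principal.
  by rewrite Quotient.idealrBE /r reprK.
move=> /asboolP[q /(congr1 (meval (set_val x 0)))].
rewrite mevalB mevalM.
have /= -> : f.@[set_val x 0] = 0 by exact: set_valP x.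
by rewrite mulr0 => /eqP; rewrite subr_eq0 => /eqP.
Qed.

Definition hypersurface : affine_variety K :=
  @AffineVariety K hypersurface_ring zeros
    (fun x => [set u | hs_eval x u = 0]).

End Hypersurface.

Section FunctionAlgebra.
Variables (T : pointedType) (K : comNzRingType) (A : comAlgType K).

Let fct_scalerAl (a : K) (F G : T -> A) : a *: (F * G) = (a *: F) * G.
Proof. by apply/funext => x; exact: scalerAl. Qed.

HB.instance Definition _ :=
  GRing.Lmodule_isLalgebra.Build K (T -> A) fct_scalerAl.
HB.instance Definition _ := GRing.Lalgebra_isComAlgebra.Build K (T -> A).

End FunctionAlgebra.

Section SLPairQuotient.
Variables (K : fieldType) (n : nat).

Definition SL := {A : 'M[K]_n | \det A == 1}.

HB.instance Definition _ := SubChoice.on SL.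

Lemma SL1_subproof : \det (1%:M : 'M[K]_n) == 1.
Proof. by rewrite det1. Qed.

HB.instance Definition _ := isPointed.Build SL (Sub 1%:M SL1_subproof).

Lemma conj_subproof (g A : SL) :
  \det (val g *m val A *m invmx (val g)) == 1.
Proof.
by rewrite !det_mulmx det_inv (eqP (valP g)) (eqP (valP A)) invr1 !mulr1.
Qed.

Definition SL_conj (g A : SL) : SL :=
  Sub (val g *m val A *m invmx (val g)) (conj_subproof g A).

Definition SL_act (g : SL) (x : SL * SL) : SL * SL :=
  (SL_conj g x.1, SL_conj g x.2).

Definition entries (x : SL * SL) : 'I_(n * n + n * n) -> K :=
  row_mx (mxvec (val x.1)) (mxvec (val x.2)) 0.

Definition polynomial_function (F : SL * SL -> K^o) : Prop :=
  exists p : {mpoly K[n * n + n * n]}, forall x, F x = p.@[entries x].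

Definition invariant_function (F : SL * SL -> K^o) : Prop :=
  forall g x, F (SL_act g x) = F x.

Definition inv_poly : {pred SL * SL -> K^o} :=
  fun F => `[< polynomial_function F /\ invariant_function F >].

Lemma inv_poly_subalg : subalg_closed inv_poly.
Proof.
split.
- apply/asboolP; split=> [|g x]; last by [].
  by exists 1 => x; rewrite meval1.
- move=> a F G /asboolP[[p Fp] Finv] /asboolP[[q Gq] Ginv]; apply/asboolP.
  split=> [|g x]; last by rewrite /= /GRing.add /GRing.scale /= Finv Ginv.
  exists (a *: p + q) => x.
  by rewrite mevalD mevalZ -Fp -Gq.
- move=> F G /asboolP[[p Fp] Finv] /asboolP[[q Gq] Ginv]; apply/asboolP.
  split=> [|g x]; last by rewrite /= /GRing.mul /= Finv Ginv.
  by exists (p * q) => x; rewrite mevalM -Fp -Gq.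
Qed.

HB.instance Definition _ :=
  GRing.isSubalgClosed.Build K (SL * SL -> K^o) inv_poly inv_poly_subalg.

Definition invariant_ring := {F : SL * SL -> K^o | inv_poly F}.

HB.instance Definition _ := SubChoice.on invariant_ring.
HB.instance Definition _ := [SubChoice_isSubComNzRing of invariant_ring by <:].
HB.instance Definition _ := [SubZmodule_isSubLmodule of invariant_ring by <:].
HB.instance Definition _ :=
  [SubNzRing_SubLmodule_isSubLalgebra of invariant_ring by <:].
HB.instance Definition _ := [SubLalgebra_isSubAlgebra of invariant_ring by <:].

Definition SL_pair_quotient : affine_variety K := Spec_max invariant_ring.

End SLPairQuotient.

(* Main.v *)
(* Write c for tr(ABA^-1B^-1), c' for tr(BAB^-1A^-1), and t for the eight traces
   of A, B, AB, AB^-1 and of their inverses.  Transposition of A and B fixes t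
   and exchanges c and c', and c + c' = P(t), c c' = Q(t), so c is a root of
   f = X^2 - P X + Q.

   Independence.  Every t for which the characteristic polynomial of A has
   distinct roots is attained, because for A diagonal the traces determine the
   diagonals of B and B^-1 linearly; hence the t are algebraically independent.
   As c <> c' generically, exchanging c and c' shows that 1 and c are linearly
   independent over the polynomials in t, and the relations are generated by f.

   Generation.  Restricted to diagonal A, an invariant F is a combination of
   torus invariant monomials in the entries of B, which are products of cycles
   b_ii, b_ij b_ji, b_ij b_jk b_ki.  These are polynomials in the eigenvalues of
   A, t and c, divided by powers of the Vandermonde determinant.  Symmetrizing,
   disc(A)^N F is a polynomial in t and c, and by symmetry so is disc(B)^M F.
   Since disc(A) and disc(B) involve disjoint sets of variables, disc(A)^N can
   be cancelled.

   Points.  The base field being uncountable and algebraically closed, every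
   maximal ideal of the ring of invariants has residue field C. *)

Require Import Defs.
From HB Require Import structures.
From mathcomp Require Import all_boot all_order all_algebra.
From mathcomp Require Import ring_quotient complex mpoly.
From mathcomp Require Import boolp classical_sets functions cardinality reals.
From mathcomp Require Import ring lra zify.

Set Implicit Arguments.
Unset Strict Implicit.
Unset Printing Implicit Defensive.

Import Order.TTheory GRing.Theory Num.Theory.

Local Open Scope classical_set_scope.
Local Open Scope ring_scope.

(** * Multivariate polynomials *)

(** Formulas are obtained for diagonal A, where only a torus still acts, and must then be carried to
    all pairs. Two facts do this: a pair with disc(A) nonzero is conjugate to one with diagonal A,
    and a product of two polynomial functions on G x G vanishes only if one factor does. The second
    fact stands in for density arguments and allows disc(A) to be cancelled.

    The denominators are the obstacle to generation. They are removed by comparing disc(A)^N F = r0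
    + r1 c with disc(B)^M F = u0 + u1 c: independence of 1 and c over the polynomials in t gives r_i
    disc(B)^M = u_i disc(A)^N. As polynomials in tr A, disc(A) has leading coefficient -4 and
    disc(B) is a nonzero constant, so univariate division shows that disc(A)^N divides r_i.

    The degree 6 comes from Q alone, and the map to the eight traces is onto because f is monic
    quadratic in c. *)

Lemma mpoly_alg_ind (n : nat) (R : comNzRingType) (P : {mpoly R[n]} -> Prop) :
  (forall c, P c%:MP) -> (forall i, P 'X_i) ->
  (forall p q, P p -> P q -> P (p + q)) ->
  (forall p q, P p -> P q -> P (p * q)) -> forall p, P p.
Proof.
move=> PC PX PD PM p; elim/mpolyind: p => [|c m p _ _ Pp]; first exact: PC 0.
apply/PD => //; rewrite -mul_mpolyC; apply/PM => //.
rewrite mpolyXE_id; apply: (big_ind P) => //; first exact: PC 1.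
move=> i _; move: (fun_of_multinom m i); elim=> [|k IHk];
  first by rewrite expr0; exact: PC 1.
by rewrite exprS; apply/PM.
Qed.

Lemma poly_fun_eq0 (K : numDomainType) (p : {poly K}) :
  (forall x, p.[x] = 0) -> p = 0.
Proof.
move=> p0; apply: (@roots_geq_poly_eq0 _ p [seq i%:R | i <- iota 0 (size p)]).
- by apply/allP => _ /mapP[i _ ->]; rewrite rootE p0.
- rewrite map_inj_uniq ?iota_uniq // => i j /eqP.
  by rewrite eqr_nat => /eqP.
- by rewrite size_map size_iota.
Qed.

Section LastVariable.
Variables (n : nat) (R : comNzRingType).

Lemma muniX_max : muni ('X_ord_max : {mpoly R[n.+1]}) = 'X.
Proof.
rewrite muniE msuppX big_seq1 mcoeffX eqxx scale1r mnm1E eqxx expr1.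
rewrite (_ : [multinom _ | i < n] = 0%MM) ?mpolyX0 ?scale1r //.
apply/mnmP => i; rewrite !mnmE; case: eqP => // /(congr1 val) /= e.
by move: (ltn_ord i); rewrite -e ltnn.
Qed.

Lemma muniX_widen (i : 'I_n) :
  muni ('X_(widen_ord (leqnSn n) i) : {mpoly R[n.+1]}) = ('X_i)%:P.
Proof.
rewrite muniE msuppX big_seq1 mcoeffX eqxx scale1r mnm1E.
rewrite (_ : _ == ord_max = false) ?expr0; last first.
  by apply/eqP => /(congr1 val) /= e; move: (ltn_ord i); rewrite e ltnn.
rewrite alg_polyC; congr ('X_[_]%:P); apply/mnmP => j.
by rewrite !mnmE.
Qed.

Lemma ordS_case (P : 'I_n.+1 -> Prop) :
  (forall i : 'I_n, P (widen_ord (leqnSn n) i)) -> P ord_max -> forall i, P i.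
Proof.
move=> Pw Pm i; have [lt_in|le_ni] := ltnP i n.
  by have := Pw (Ordinal lt_in); congr P; apply: val_inj.
by rewrite (_ : i = ord_max) //; apply: val_inj => /=; apply/eqP;
  rewrite eqn_leq le_ni -ltnS ltn_ord.
Qed.

(** The inverse of [muni], which singles out the last variable; it carries quotients of univariate
    polynomials back to several variables. *)
Definition unmuni (q : {poly {mpoly R[n]}}) : {mpoly R[n.+1]} :=
  (map_poly (@mwiden n R) q).['X_ord_max].

Lemma unmuniD : {morph unmuni : p q / p + q}.
Proof. by move=> p q; rewrite /unmuni !rmorphD /= hornerD. Qed.

Lemma unmuniM : {morph unmuni : p q / p * q}.
Proof. by move=> p q; rewrite /unmuni rmorphM hornerM. Qed.

Lemma muniK : cancel (@muni n R) unmuni.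
Proof.
elim/mpoly_alg_ind => [c|i|p q IHp IHq|p q IHp IHq].
- by rewrite muniC /unmuni map_polyC hornerC /= mwidenC.
- move: i; apply: ordS_case => [i|].
    by rewrite muniX_widen /unmuni map_polyC hornerC /= mwidenX mnmwiden1.
  by rewrite muniX_max /unmuni map_polyX hornerX.
- exact: etrans (congr1 unmuni (muniD p q)) (etrans (unmuniD _ _) (congr2 +%R
  IHp IHq)).
- exact: etrans (congr1 unmuni (muniM p q)) (etrans (unmuniM _ _) (congr2 *%R
  IHp IHq)).
Qed.

Lemma meval_muni (v : 'I_n.+1 -> R) p :
  p.@[v] = (map_poly (meval (v \o widen_ord (leqnSn n))) (muni p)).[v ord_max].
Proof.
elim/mpoly_alg_ind: p => [c|i|p q IHp IHq|p q IHp IHq].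
- by rewrite muniC map_polyC hornerC /= !mevalC.
- move: i; apply: ordS_case => [i|].
    by rewrite muniX_widen map_polyC hornerC /= !mevalXU.
  by rewrite muniX_max map_polyX hornerX mevalXU.
- by rewrite mevalD muniD IHp IHq -hornerD -rmorphD.
- by rewrite mevalM muniM IHp IHq -hornerM -rmorphM.
Qed.

End LastVariable.

Lemma mpoly_fun_eq0 (K : numDomainType) n (p : {mpoly K[n]}) :
  (forall v, p.@[v] = 0) -> p = 0.
Proof.
elim: n p => [|n IHn] p p0.
  apply/mpolyP => m; rewrite mcoeff0.
  have p1 : (msize p <= 1)%N.
    rewrite msizeE; apply/bigmax_leqP_seq => k _ _.
    by rewrite /mdeg ltnS; case: k => -[[|] // ] //= _; rewrite big_nil.
  have := p0 (fun=> 0); rewrite (msize1_polyC p1) mevalC => ->.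
  by rewrite mcoeff0.
rewrite -[p]muniK (_ : muni p = 0) ?/unmuni ?rmorph0 ?horner0 //.
apply/polyP => i; rewrite coef0; apply: IHn => v.
have /polyP /(_ i) : map_poly (meval v) (muni p) = 0.
  apply: poly_fun_eq0 => x.
  pose v' (j : 'I_n.+1) := oapp v x (insub (val j)).
  have := p0 v'; rewrite meval_muni.
  rewrite {2}/v' insubF /= ?ltnn // => <-.
  congr (_.[_]); apply: eq_map_poly => q; apply: meval_eq => j /=.
  rewrite /v' insubT /= ?ltn_ord // => h; congr v; exact: val_inj.
by rewrite coef_map coef0.
Qed.

(** After division of [p] by [d], [c] times the remainder is a multiple of [d] of smaller size than
    [d], hence zero, and the nonzero constant [c] cancels. *)
Lemma dvdp_of_polyCM (R : idomainType) (c : R) (d p q : {poly R}) :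
  c != 0 -> lead_coef d \is a GRing.unit -> c%:P * p = d * q ->
  exists r, p = d * r.
Proof.
move=> c0 ud eq_cp; exists (p %/ d).
have d0 : d != 0 by rewrite -lead_coef_eq0; apply: contraTneq ud => ->;
  rewrite unitr0.
have := Pdiv.IdomainUnit.divp_eq ud p; set r := p %% d => ep.
have : c%:P * r = d * (q - c%:P * (p %/ d)).
  by rewrite mulrBr -eq_cp {1}ep; ring.
set s := q - _; have [->|s0] := eqVneq s 0.
  rewrite mulr0 => /eqP; rewrite mulf_eq0 polyC_eq0 (negPf c0) => /eqP r0.
  by rewrite {1}ep r0 addr0 mulrC.
move=> /(congr1 (fun p : {poly R} => size p)).
rewrite size_Cmul // size_mul // => e.
have : (size r < size d)%N by rewrite ltn_modp.
rewrite e; move: s0; rewrite -size_poly_gt0; case: (size s) => // k _.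
by rewrite addnS /= ltnNge leq_addr.
Qed.

(** * Polynomial functions on pairs of unimodular matrices *)

Section PolynomialFunctions.
Variables (K : fieldType) (n : nat).
Implicit Types F G : SL K n * SL K n -> K.
Local Notation polyfun := (@polynomial_function K n).

Lemma polyfun_cst (c : K) : polyfun (fun=> c).
Proof. by exists c%:MP => x; rewrite mevalC. Qed.

Lemma polyfunD F G : polyfun F -> polyfun G ->
  polyfun (fun x => F x + G x).
Proof. by move=> [p Fp] [q Gq]; exists (p + q) => x;
  rewrite mevalD -Fp -Gq. Qed.

Lemma polyfunM F G : polyfun F -> polyfun G ->
  polyfun (fun x => F x * G x).
Proof. by move=> [p Fp] [q Gq]; exists (p * q) => x;
  rewrite mevalM -Fp -Gq. Qed.

Lemma polyfunN F : polyfun F -> polyfun (fun x => - F x).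
Proof. by move=> [p Fp]; exists (- p) => x; rewrite mevalN -Fp. Qed.

Lemma polyfunX F k : polyfun F ->
  polyfun (fun x => F x ^+ k).
Proof. by move=> [p Fp]; exists (p ^+ k) => x; rewrite rmorphXn /= -Fp. Qed.

Lemma polyfun_sum (I : Type) (r : seq I) (P : pred I)
    (f : I -> SL K n * SL K n -> K) :
  (forall i, polyfun (f i)) ->
  polyfun (fun x => \sum_(i <- r | P i) f i x).
Proof.
move=> pf; elim: r => [|i r [p IH]].
  by exists 0 => x; rewrite big_nil meval0.
case Pi: (P i); last by exists p => x; rewrite big_cons Pi.
by have [q fq] := pf i; exists (q + p) => x; rewrite big_cons Pi mevalD -fq IH.
Qed.

Lemma polyfun_prod (I : Type) (r : seq I) (P : pred I)
    (f : I -> SL K n * SL K n -> K) :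
  (forall i, polyfun (f i)) ->
  polyfun (fun x => \prod_(i <- r | P i) (f i x)).
Proof.
move=> pf; elim: r => [|i r [p IH]].
  by exists 1 => x; rewrite big_nil meval1.
case Pi: (P i); last by exists p => x; rewrite big_cons Pi.
by have [q fq] := pf i; exists (q * p) => x; rewrite big_cons Pi mevalM -fq IH.
Qed.

Lemma polyfun_mpoly k (p : {mpoly K[k]}) (e : SL K n * SL K n -> 'I_k -> K) :
  (forall i, polyfun (fun x => e x i)) ->
  polyfun (fun x => p.@[e x]).
Proof.
move=> pe; elim/mpoly_alg_ind: p =>
  [c|i|p q [p' IHp] [q' IHq]|p q [p' IHp] [q' IHq]].
- by exists c%:MP => x; rewrite !mevalC.
- by have [p ep] := pe i; exists p => x; rewrite mevalXU -ep.
- by exists (p' + q') => x; rewrite !mevalD -IHp -IHq.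
- by exists (p' * q') => x; rewrite !mevalM -IHp -IHq.
Qed.

Definition polyfun_mx a b (f : SL K n * SL K n -> 'M[K]_(a, b)) :=
  forall i j, polyfun (fun x => f x i j).

Lemma entriesl (x : SL K n * SL K n) i j :
  entries x (lshift _ (mxvec_index i j)) = val x.1 i j.
Proof. by rewrite /entries row_mxEl mxvecE. Qed.

Lemma entriesr (x : SL K n * SL K n) i j :
  entries x (rshift _ (mxvec_index i j)) = val x.2 i j.
Proof. by rewrite /entries row_mxEr mxvecE. Qed.

Lemma entries_case (P : 'I_(n * n + n * n) -> Prop) :
  (forall i j, P (lshift _ (mxvec_index i j))) ->
  (forall i j, P (rshift _ (mxvec_index i j))) -> forall k, P k.
Proof.
move=> Pl Pr k; rewrite -[k]fintype.splitK; case: (fintype.split k) => j /=.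
  by case/mxvec_indexP: j.
by case/mxvec_indexP: j.
Qed.

Lemma polyfun_fst : polyfun_mx (fun x => val x.1).
Proof. by move=> i j; exists 'X_(lshift _ (mxvec_index i j)) => x;
  rewrite mevalXU entriesl. Qed.

Lemma polyfun_snd : polyfun_mx (fun x => val x.2).
Proof. by move=> i j; exists 'X_(rshift _ (mxvec_index i j)) => x;
  rewrite mevalXU entriesr. Qed.

Lemma polyfun_mulmx a b c (f : SL K n * SL K n -> 'M[K]_(a, b))
    (g : SL K n * SL K n -> 'M[K]_(b, c)) :
  polyfun_mx f -> polyfun_mx g -> polyfun_mx (fun x => f x *m g x).
Proof.
move=> pf pg i j.
have [p ep] : polyfun (fun x => \sum_k (f x i k * g x k j)).
  by apply: polyfun_sum => k; apply: polyfunM.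
by exists p => x; rewrite mxE ep.
Qed.

Lemma polyfun_det a (f : SL K n * SL K n -> 'M[K]_a) :
  polyfun_mx f -> polyfun (fun x => \det (f x)).
Proof.
move=> pf; rewrite /determinant; apply: polyfun_sum => s.
apply: polyfunM; first exact: polyfun_cst.
by apply: polyfun_prod => i; exact: pf.
Qed.

Lemma polyfun_adj a (f : SL K n * SL K n -> 'M[K]_a) :
  polyfun_mx f -> polyfun_mx (fun x => \adj (f x)).
Proof.
move=> pf i j.
have [p ep] : polyfun (fun x => cofactor (f x) j i).
  rewrite /cofactor; apply: polyfunM; first exact: polyfun_cst.
  apply: polyfun_det => k l.
  by have [p ep] := pf (lift j k) (lift i l); exists p => x; rewrite !mxE ep.
by exists p => x; rewrite mxE ep.
Qed.

Lemma polyfun_tr a (f : SL K n * SL K n -> 'M[K]_a) :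
  polyfun_mx f -> polyfun (fun x => \tr (f x)).
Proof. by move=> pf; apply: polyfun_sum => i; exact: pf. Qed.

Lemma SL_det (A : SL K n) : \det (val A) = 1.
Proof. exact: (eqP (valP A)). Qed.

Lemma SL_unit (A : SL K n) : val A \in unitmx.
Proof. by rewrite unitmxE SL_det unitr1. Qed.

(** Determinant 1 makes the inverse polynomial in the entries; the adjugate stands for it in all
    polynomial functions below. *)
Lemma SL_inv (A : SL K n) : invmx (val A) = \adj (val A).
Proof. by rewrite /invmx SL_unit SL_det invr1 scale1r. Qed.

End PolynomialFunctions.

(** * Absence of zero divisors among polynomial functions on pairs *)

Section RationalFunctions.
Variables (K : fieldType) (d : {poly K}).

(** Regularity away from the zeros of [d], with the denominator cleared; where [d] vanishes, [g] is
    unconstrained. *)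
Definition rational (g : K -> K) :=
  exists k (q : {poly K}), forall s, d.[s] != 0 -> g s * d.[s] ^+ k = q.[s].

Lemma rationalD g h : rational g -> rational h -> rational (fun s => g s + h s).
Proof.
move=> [k [p gp]] [l [q hq]];
  exists (k + l)%N, (p * d ^+ l + q * d ^+ k) => s ds.
rewrite hornerD !hornerM !horner_exp -gp // -hq // exprD; ring.
Qed.

Lemma rationalM g h : rational g -> rational h -> rational (fun s => g s * h s).
Proof.
move=> [k [p gp]] [l [q hq]]; exists (k + l)%N, (p * q) => s ds.
rewrite hornerM -gp // -hq // exprD; ring.
Qed.

Lemma rational_mpoly n (p : {mpoly K[n]}) (e : K -> 'I_n -> K) :
  (forall i, rational (fun s => e s i)) -> rational (fun s => p.@[e s]).
Proof.
move=> re; elim/mpoly_alg_ind: p => [c|i|p q IHp IHq|p q IHp IHq].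
- by exists 0%N, c%:P => s _; rewrite mevalC hornerC mulr1.
- have [k [q eq_]] := re i; exists k, q => s ds.
  by rewrite mevalXU eq_.
- have [k [r er]] := rationalD IHp IHq; exists k, r => s ds.
  by rewrite mevalD er.
- have [k [r er]] := rationalM IHp IHq; exists k, r => s ds.
  by rewrite mevalM er.
Qed.

End RationalFunctions.

Section Domain.
Variables (K : numFieldType) (n : nat).
Local Notation SLn := (SL K n.+1).

Definition SL_scaling (M : 'M[K]_n.+1) : 'M[K]_n.+1 :=
  diag_mx (\row_j (if j == 0 then (\det M)^-1 else 1)).

Lemma det_SL_scaling M : \det (SL_scaling M) = (\det M)^-1.
Proof.
rewrite det_diag (bigD1 0) //= mxE eqxx big1 ?mulr1 // => j j0.
by rewrite mxE (negPf j0).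
Qed.

(** Divides the first row by the determinant. A singular matrix is sent to the default value, the
    identity, which keeps the map total. *)
Definition to_SL (M : 'M[K]_n.+1) : SLn :=
  insubd (Sub 1%:M (SL1_subproof K n.+1) : SLn) (SL_scaling M *m M).

Lemma to_SLE M : \det M != 0 -> val (to_SL M) = SL_scaling M *m M.
Proof.
move=> M0; rewrite val_insubd det_mulmx det_SL_scaling mulVf //.
by rewrite eqxx.
Qed.

Lemma to_SL_entry M i j : \det M != 0 ->
  val (to_SL M) i j = (if i == 0 then (\det M)^-1 else 1) * M i j.
Proof. by move=> M0; rewrite to_SLE // mul_diag_mx !mxE. Qed.

Lemma to_SL_id (A : SLn) : to_SL (val A) = A.
Proof.
apply: val_inj; rewrite to_SLE; last by rewrite SL_det oner_eq0.
rewrite /SL_scaling SL_det (_ :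
  \row__ _ = const_mx 1) ?diag_const_mx ?mul1mx //.
by apply/rowP => j; rewrite !mxE invr1 if_same.
Qed.

(* Two points of SL x SL are joined by a rational curve: the line between two
   matrices, with the first row divided by the determinant. *)
Lemma polyfun_domain (F G : SLn * SLn -> K^o) (x1 : SLn * SLn) :
  polynomial_function F -> polynomial_function G ->
  (forall x, (F x : K) * G x = 0) -> F x1 != 0 -> forall x, G x = 0.
Proof.
move=> [p Fp] [q Gq] FG0 Fx1 x0; apply/eqP; apply: contraNT Fx1 => Gx0.
pose path (A B : SLn) : 'M[{poly K}]_n.+1 :=
  (1 - 'X) *: map_mx polyC (val A) + 'X *: map_mx polyC (val B).
pose MA := path x0.1 x1.1; pose MB := path x0.2 x1.2.
pose d := \det MA * \det MB.
pose ev s (M : 'M[{poly K}]_n.+1) := map_mx (horner_eval s) M.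
pose gam s := (to_SL (ev s MA), to_SL (ev s MB)).
have ev_det s M : \det (ev s M) = (\det M).[s] by rewrite det_map_mx.
have ev0 A B : ev 0 (path A B) = val A.
  by apply/matrixP => i j; rewrite !mxE /horner_eval !hornerE /=; ring.
have ev1 A B : ev 1 (path A B) = val B.
  by apply/matrixP => i j; rewrite !mxE /horner_eval !hornerE /=; ring.
have gam0 : gam 0 = x0 by rewrite /gam !ev0 !to_SL_id; case: (x0).
have gam1 : gam 1 = x1 by rewrite /gam !ev1 !to_SL_id; case: (x1).
have evE s M i j : ev s M i j = (M i j).[s] by rewrite mxE.
have d0 : d.[0] = 1 by rewrite hornerM -!ev_det !ev0 !SL_det mulr1.
have d1 : d.[1] = 1 by rewrite hornerM -!ev_det !ev1 !SL_det mulr1.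
have dA s : d.[s] != 0 -> \det (ev s MA) != 0 /\ \det (ev s MB) != 0.
  by rewrite hornerM mulf_eq0 negb_or !ev_det => /andP.
have rat i : rational d (fun s => entries (gam s) i).
  elim/entries_case: i => i j.
    exists 1%N, ((if i == 0 then \det MB else d) * MA i j) => s ds.
    have [sA sB] := dA s ds.
    rewrite entriesl to_SL_entry // evE expr1 [RHS]hornerM.
    case: (i == 0); last by rewrite mul1r mulrC.
    rewrite ev_det [d.[s]]hornerM; rewrite ev_det in sA; field.
    exact: sA.
  exists 1%N, ((if i == 0 then \det MA else d) * MB i j) => s ds.
  have [sA sB] := dA s ds.
  rewrite entriesr to_SL_entry // evE expr1 [RHS]hornerM.
  case: (i == 0); last by rewrite mul1r mulrC.
  rewrite ev_det [d.[s]]hornerM; rewrite ev_det in sB; field.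
  exact: sB.
have [k [f ef]] := rational_mpoly p rat.
have [l [g eg]] := rational_mpoly q rat.
(* The factor [d] covers the parameters at which the curve is not defined. At 0, [d] is 1 and [g]
   takes the nonzero value [G x0]; hence [f] is zero, and its value at 1 is [F x1]. *)
have : d * f * g = 0.
  apply: poly_fun_eq0 => s; rewrite 2!hornerM.
  have [->|ds] := eqVneq d.[s] 0; first by rewrite !mul0r.
  have := FG0 (gam s); rewrite Fp Gq -ef // -eg // => e.
  rewrite -mulrA [X in _ * X](_ :
    _ = p.@[entries (gam s)] * q.@[entries (gam s)] * d.[s] ^+ k * d.[s] ^+ l);
    last by ring.
  by rewrite e !mul0r mulr0.
move/eqP; rewrite 2!mulf_eq0 => /orP[/orP[]|] /eqP e.
- by move: d0; rewrite e horner0 => /esym/eqP; rewrite oner_eq0.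
- have := ef 1; rewrite d1 oner_eq0 expr1n mulr1 gam1 e horner0 -Fp => -> //.
- have := eg 0; rewrite d0 oner_eq0 expr1n mulr1 gam0 e horner0 -Gq =>
  /(_ isT) G0.
  by rewrite G0 eqxx in Gx0.
Qed.

End Domain.

(** * Matrices of size 3 *)

Section M3.
Variable R : comNzRingType.
Implicit Types M : 'M[R]_3.

Lemma sum_ord3 (V : nmodType) (F : 'I_3 -> V) :
  \sum_i F i = F 0 + F 1 + F (2%:R).
Proof.
rewrite !big_ord_recl big_ord0 addr0 addrA; congr (_ + F _ + F _);
  exact: val_inj.
Qed.

Lemma ord3_ind (P : 'I_3 -> Prop) : P 0 -> P 1 -> P (2%:R) -> forall i, P i.
Proof.
move=> P0 P1 P2 [[|[|[|]]]] //= i.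
- by rewrite (_ : Ordinal i = 0) //; apply: val_inj.
- by rewrite (_ : Ordinal i = 1) //; apply: val_inj.
- by rewrite (_ : Ordinal i = 2%:R) //; apply: val_inj.
Qed.

Lemma det2 (M : 'M[R]_2) : \det M = M 0 0 * M 1 1 - M 0 1 * M 1 0.
Proof.
rewrite (expand_det_row _ 0) !big_ord_recl big_ord0 /cofactor !det_mx11 !mxE /=
  addr0.
rewrite expr0 expr1 mul1r mulN1r mulrN; congr (M _ _ * M _ _ - M _ _ * M _ _);
  exact: val_inj.
Qed.

(** Indices are added modulo 3: listing the remaining rows and columns in cyclic order absorbs the
    signs of the cofactors. *)
Lemma adj3 M i j : \adj M i j =
  M (j + 1) (i + 1) * M (j + 2%:R) (i + 2%:R) - M (j + 1) (i + 2%:R) * M (j +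
    2%:R) (i + 1).
Proof.
rewrite mxE /cofactor det2 !mxE.
move: i j; elim/ord3_ind; elim/ord3_ind => /=;
  rewrite ?expr0 ?expr1 ?mul1r ?sqrrN ?expr1n ?mul1r ?mulN1r ?opprB.
all: rewrite ?mul1r -1?signr_odd /= ?expr0 ?mul1r ?expr1 ?mulN1r ?opprB.
all: try by congr (M _ _ * M _ _ - M _ _ * M _ _); exact: val_inj.
all: rewrite [X in X - _]mulrC [X in _ - X]mulrC.
all: try by congr (M _ _ * M _ _ - M _ _ * M _ _); exact: val_inj.
Qed.


Definition mx3 (a b c d e f g h k : R) : 'M[R]_3 :=
  \matrix_(i, j) nth 0 (nth [::] [:: [:: a; b; c]; [:: d; e; f]; [:: g; h;
    k]] i) j.

Lemma mx3_eta M : M = mx3 (M 0 0) (M 0 1) (M 0 2%:R) (M 1 0) (M 1 1) (M 1 2%:R)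
  (M 2%:R 0) (M 2%:R 1) (M 2%:R 2%:R).
Proof. by apply/matrixP; elim/ord3_ind; elim/ord3_ind; rewrite mxE. Qed.

(** Replaces a matrix by nine indeterminates, so that matrix identities become goals for [ring]. *)
Lemma mx3P (P : 'M[R]_3 -> Prop) :
  (forall a b c d e f g h k, P (mx3 a b c d e f g h k)) -> forall M, P M.
Proof. by move=> Pmx M; rewrite [M]mx3_eta. Qed.

Lemma tr_mx3 a b c d e f g h k : \tr (mx3 a b c d e f g h k) = a + e + k.
Proof. by rewrite /mxtrace sum_ord3 !mxE. Qed.

Lemma mul_mx3 a b c d e f g h k a' b' c' d' e' f' g' h' k' :
  mx3 a b c d e f g h k *m mx3 a' b' c' d' e' f' g' h' k' =
  mx3 (a * a' + b * d' + c * g') (a * b' + b * e' + c * h') (a * c' + b * f' +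
    c * k')
      (d * a' + e * d' + f * g') (d * b' + e * e' + f * h') (d * c' + e * f' +
        f * k')
      (g * a' + h * d' + k * g') (g * b' + h * e' + k * h') (g * c' + h * f' +
        k * k').
Proof. by apply/matrixP; elim/ord3_ind; elim/ord3_ind;
  rewrite mxE sum_ord3 !mxE. Qed.

Lemma adj_mx3 a b c d e f g h k : \adj (mx3 a b c d e f g h k) =
  mx3 (e * k - f * h) (c * h - b * k) (b * f - c * e)
      (f * g - d * k) (a * k - c * g) (c * d - a * f)
      (d * h - e * g) (b * g - a * h) (a * e - b * d).
Proof.
by apply/matrixP; elim/ord3_ind; elim/ord3_ind; rewrite adj3 !mxE /=; ring.
Qed.

Lemma det_mx3 a b c d e f g h k :
  \det (mx3 a b c d e f g h k) =
  a * (e * k - f * h) - b * (d * k - f * g) + c * (d * h - e * g).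
Proof.
have := mul_mx_adj (mx3 a b c d e f g h k).
rewrite adj_mx3 mul_mx3 => /matrixP/(_ 0 0); rewrite !mxE /= mulr1n => <-; ring.
Qed.

Lemma diag_mx3 (v : 'rV[R]_3) :
  diag_mx v = mx3 (v 0 0) 0 0 0 (v 0 1) 0 0 0 (v 0 2%:R).
Proof. by apply/matrixP; elim/ord3_ind; elim/ord3_ind; rewrite !mxE. Qed.

End M3.

(** * Commutator traces, discriminants and diagonalization *)

Section CommutatorTrace.
Variable R : comNzRingType.
Implicit Types A B : 'M[R]_3.

(* [commP] and [commQ] express the sum and the product of tr(ABA^-1B^-1) and
   tr(BAB^-1A^-1) through y = tr A^-1, z = tr B, w = tr B^-1, k = tr AB,
   l = tr A^-1B^-1, m = tr AB^-1, n = tr A^-1B and x = tr A.  Adjugates replace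
   inverses, and the variables e = det A, d = det B make both expressions
   bihomogeneous, so that they become polynomial identities. *)
Definition commP (e d y z w k l m n x : R) : R :=
  y * z * w * x - y * z * m - y * w * k - z * l * x - w * n * x + y * x * d
  + z * w * e + k * l + m * n - 3%:R * e * d.

Definition commQ (e d y z w k l m n x : R) : R :=
  y ^+ 2 * z * w * x ^+ 2 * d + y * z ^+ 2 * w ^+ 2 * x * e
  - y ^+ 3 * z * w * d + y ^+ 2 * z ^+ 2 * n * d - y ^+ 2 * z * m * x * d
  + y ^+ 2 * w ^+ 2 * l - y ^+ 2 * w * k * x * d - y * z ^+ 3 * x * e * d
  - y * z ^+ 2 * w * m * e - y * z * w ^+ 2 * k * e - y * z * w * l * n
  - y * z * k * n * x * d - y * z * l * x ^+ 2 * d - y * w ^+ 3 * x * e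
  - y * w * l * m * x - y * w * n * x ^+ 2 * d - z ^+ 2 * w * l * x * e
  + z ^+ 2 * k * x ^+ 2 * e * d - z * w ^+ 2 * n * x * e
  - z * w * k * m * x * e - z * w * x ^+ 3 * e * d + w ^+ 2 * m * x ^+ 2 * e
  + y ^+ 2 * z * l * d + y ^+ 2 * w * n * d + y ^+ 2 * k * m * d
  + y * z ^+ 2 * k * e * d + y * z * w * x * e * d
  - 2%:R * y * z * n ^+ 2 * d + y * w ^+ 2 * m * e - 2%:R * y * w * l ^+ 2
  + y * k ^+ 2 * n * d + y * k * l * x * d + y * l * m ^+ 2
  + y * m * n * x * d + z ^+ 2 * l * m * e + z ^+ 2 * n * x * e * d
  + z * w * k * l * e + z * w * m * n * e - 2%:R * z * k ^+ 2 * x * e * d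
  + z * k * m ^+ 2 * e + z * l ^+ 2 * n + z * m * x ^+ 2 * e * d
  + w ^+ 2 * k * n * e + w ^+ 2 * l * x * e + w * k ^+ 2 * m * e
  + w * k * x ^+ 2 * e * d + w * l * n ^+ 2 - 2%:R * w * m ^+ 2 * x * e
  + k * l * m * n + k * n ^+ 2 * x * d + l ^+ 2 * m * x + l * n * x ^+ 2 * d
  + y ^+ 3 * d ^+ 2 + 3%:R * y * z * m * e * d + 3%:R * y * w * k * e * d
  - 3%:R * y * l * n * d + z ^+ 3 * e ^+ 2 * d - 3%:R * z * k * n * e * d
  + 3%:R * z * l * x * e * d + w ^+ 3 * e ^+ 2 - 3%:R * w * l * m * e
  + 3%:R * w * n * x * e * d + k ^+ 3 * e * d - 3%:R * k * m * x * e * d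
  + l ^+ 3 + m ^+ 3 * e + n ^+ 3 * d + x ^+ 3 * e * d ^+ 2
  - 6%:R * y * x * e * d ^+ 2 - 6%:R * z * w * e ^+ 2 * d
  - 6%:R * k * l * e * d - 6%:R * m * n * e * d + 9%:R * e ^+ 2 * d ^+ 2.

Definition tcomm A B : R := \tr (A *m B *m \adj A *m \adj B).

Definition on_traces (S : Type) (F : R -> R -> R -> R -> R -> R -> R -> R ->
  R -> R -> S) A B :=
  F (\det A) (\det B) (\tr (\adj A)) (\tr B) (\tr (\adj B)) (\tr (A *m B))
   (\tr (\adj A *m \adj B)) (\tr (A *m \adj B)) (\tr (\adj A *m B)) (\tr A).

Definition diag3 (a b c : R) := mx3 a 0 0 0 b 0 0 0 c.

(** With one matrix diagonal, only twelve indeterminates remain and the identity is checked by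
    expansion; [polyfun_eq_slice] later extends it to all pairs in SL(3). *)
Lemma tcomm_diag_sum a b c B :
  tcomm (diag3 a b c) B + tcomm B (diag3 a b c) =
    on_traces commP (diag3 a b c) B.
Proof.
elim/mx3P: B => b1 b2 b3 b4 b5 b6 b7 b8 b9.
rewrite /on_traces /tcomm /diag3 !adj_mx3 !mul_mx3 !tr_mx3 !det_mx3 /commP.
ring.
Qed.

Lemma tcomm_diag_prod a b c B :
  tcomm (diag3 a b c) B * tcomm B (diag3 a b c) =
    on_traces commQ (diag3 a b c) B.
Proof.
elim/mx3P: B => b1 b2 b3 b4 b5 b6 b7 b8 b9.
rewrite /on_traces /tcomm /diag3 !adj_mx3 !mul_mx3 !tr_mx3 !det_mx3 /commQ.
ring.
Qed.

(** The discriminant of X^3 - x X^2 + y X - 1, the characteristic polynomial of a unimodular matrix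
    with trace [x] whose inverse has trace [y]. *)
Definition disc (y x : R) : R :=
  x ^+ 2 * y ^+ 2 - 4%:R * x ^+ 3 - 4%:R * y ^+ 3 + 18%:R * x * y - 27%:R.

Definition vander (a b c : R) : R := (a - b) * (a - c) * (b - c).

Lemma disc_vander a b c : a * b * c = 1 ->
  disc (a * b + a * c + b * c) (a + b + c) = vander a b c ^+ 2.
Proof.
have : vander a b c ^+ 2 = (a + b + c) ^+ 2 * (a * b + a * c + b * c) ^+ 2 -
    4%:R * (a + b + c) ^+ 3 * (a * b * c) - 4%:R * (a * b + a * c +
      b * c) ^+ 3 +
    18%:R * (a + b + c) * (a * b + a * c + b * c) * (a * b * c) -
    27%:R * (a * b * c) ^+ 2 by rewrite /vander; ring.
by move=> -> ->; rewrite expr1n !mulr1.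
Qed.

Lemma det_sub_eigen A a :
  \det (A - a%:M) = \det A - \tr (\adj A) * a + \tr A * a ^+ 2 - a ^+ 3.
Proof.
elim/mx3P: A => b1 b2 b3 b4 b5 b6 b7 b8 b9.
have -> : mx3 b1 b2 b3 b4 b5 b6 b7 b8 b9 - a%:M =
   mx3 (b1 - a) b2 b3 b4 (b5 - a) b6 b7 b8 (b9 - a).
  apply/matrixP; elim/ord3_ind; elim/ord3_ind;
    rewrite !mxE /= ?mulr1n ?mulr0n ?subr0 //.
rewrite adj_mx3 !det_mx3 !tr_mx3; ring.
Qed.

End CommutatorTrace.

(** The three numbers are the roots of X^3 - x X^2 + y X - 1. *)
Lemma cubic_roots (K : closedFieldType) (x y : K) :
  exists a b c, [/\ a + b + c = x, a * b + a * c + b * c = y & a * b * c = 1].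
Proof.
pose p : {poly K} := 'X^3 - x *: 'X^2 + y *: 'X - 1%:P.
have p3 : size p = 4.
  rewrite /p -!addrA size_polyDl size_polyXn // (leq_ltn_trans (size_polyD _
    _)) //.
  rewrite gtn_max size_polyN (leq_ltn_trans (size_scale_leq _ _)) ?size_polyXn
    //=.
  rewrite (leq_ltn_trans (size_polyD _ _)) // gtn_max size_polyN size_polyC.
  by rewrite (leq_ltn_trans (size_scale_leq _ _)) ?size_polyX //=
    (leq_ltn_trans (leq_b1 _)).
have pm : lead_coef p = 1.
  by rewrite lead_coefE p3 /p !coefE /= !mulr0 !subr0 addr0.
have [r er] := closed_field_poly_normal p.
have := congr1 (fun q : {poly K} => size q) er.
rewrite p3 pm scale1r size_prod_XsubC => -[].
case: r er => [|a [|b [|c []]]] // er _.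
exists a, b, c.
move: er; rewrite pm scale1r !big_cons big_nil mulr1 => er.
have E (z : K) : z ^+ 3 - x * z ^+ 2 +
  y * z - 1 = (z - a) * ((z - b) * (z - c)).
  have := congr1 (horner^~ z) er; rewrite !hornerE /= => <- //.
have e0 : (a * b * c) = 1.
  have := E 0; rewrite !expr0n /= !mulr0 => e; apply/eqP; rewrite -subr_eq0.
  apply/eqP; transitivity ((0 - 0 + 0 - 1) - (0 - a) * ((0 - b) * (0 - c)));
    last first.
    by rewrite -e subrr.
  ring.
have coefs i := congr1 (fun q : {poly K} => q`_i) er.
have := coefs 1%N; have := coefs 2.
have -> : ('X - a%:P) * (('X - b%:P) * ('X - c%:P)) =
  'X^3 - (a + b + c) *: 'X^2 + (a * b + a * c +
    b * c) *: 'X - (a * b * c)%:P :> {poly K}.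
  rewrite -!mul_polyC !rmorphD !rmorphM /=; ring.
rewrite /p !coefE /= !mulr0 !mulr1 !addr0 !subr0 !sub0r !add0r =>
  /oppr_inj -> ->.
by split.
Qed.

Lemma SL_conj_eq (K : fieldType) (n : nat) (g A : SL K n) (D : 'M[K]_n) :
  val g *m val A = D *m val g -> val (SL_conj g A) = D.
Proof. by move=> e; rewrite /= e mulmxK // SL_unit. Qed.

(** The rows of [G] are left eigenvectors for the three distinct eigenvalues. Normalizing the
    determinant of [G] multiplies it by a diagonal matrix, which commutes with [diag3 a b c]. *)
Lemma diagonalize (K : numFieldType) (A : SL K 3) a b c :
  a + b + c = \tr (val A) -> a * b + a * c + b * c = \tr (\adj (val A)) ->
  a * b * c = 1 -> vander a b c != 0 ->
  exists g : SL K 3, val (SL_conj g A) = diag3 a b c.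
Proof.
move=> e1 e2 e3; rewrite !mulf_eq0 !negb_or !subr_eq0 => /andP[/andP[ab ac] bc].
have eig z : (z - a) * (z - b) * (z - c) = 0 ->
    exists2 v : 'rV_3, v != 0 & v *m val A = z *: v.
  move=> z0; have : \det (val A - z%:M) == 0.
    rewrite det_sub_eigen -e1 -e2 SL_det -e3 -oppr_eq0.
    by apply/eqP; rewrite -[RHS]z0; ring.
  move=> /eqP/eqP/det0P[v v0 /eqP];
    rewrite mulmxBr mul_mx_scalar subr_eq0 => /eqP ev.
  by exists v.
have [u u0 eu] : exists2 v : 'rV_3, v != 0 & v *m val A = a *: v.
  by apply: eig; rewrite subrr !mul0r.
have [v v0 ev] : exists2 v : 'rV_3, v != 0 & v *m val A = b *: v.
  by apply: eig; rewrite subrr mulr0 mul0r.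
have [w w0 ew] : exists2 v : 'rV_3, v != 0 & v *m val A = c *: v.
  by apply: eig; rewrite subrr mulr0.
pose G : 'M[K]_3 := \matrix_(i, j) nth 0 [:: u; v; w] i 0 j.
have mulG (z : 'rV_3) : z *m G = z 0 0 *: u + z 0 1 *: v + z 0 2%:R *: w.
  by apply/rowP => j; rewrite !mxE sum_ord3 !mxE.
have GA : G *m val A = diag3 a b c *m G.
  apply/row_matrixP; elim/ord3_ind; rewrite !row_mul mulG !mxE /=.
  - rewrite !scale0r 2!addr0 -eu; congr (_ *m _); apply/rowP => j;
    by rewrite !mxE.
  - rewrite !scale0r addr0 add0r -ev; congr (_ *m _); apply/rowP => j;
    by rewrite !mxE.
  - rewrite !scale0r !add0r -ew; congr (_ *m _); apply/rowP => j;
    by rewrite !mxE.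
(* Multiplying the relation by (A - t)(A - r) removes the eigenvectors for [t] and [r] and leaves x
   (s - t)(s - r) p = 0. *)
have kill (s t r : K) (p q o : 'rV[K]_3) (x y z : K) : p != 0 ->
    p *m val A = s *: p -> q *m val A = t *: q -> o *m val A = r *: o ->
    s != t -> s != r -> x *: p + y *: q + z *: o = 0 -> x = 0.
  move=> p0 ep eq_ eo st sr /(congr1 (fun m =>
    m *m (val A - t%:M) *m (val A - r%:M))).
  have S (s' t' : K) (p' : 'rV[K]_3) : p' *m val A = s' *: p' ->
      p' *m (val A - t'%:M) = (s' - t') *: p'.
    by move=> ep'; rewrite mulmxBr mul_mx_scalar ep' scalerBl.
  rewrite !mul0mx !mulmxDl -!scalemxAl (S s t p) // (S t t q) // (S r t o) //.
  rewrite -!scalemxAl (S s r p) // (S t r q) // (S r r o) // !subrr.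
  rewrite !scale0r !scaler0 !addr0 !scalerA => /eqP.
  rewrite scaler_eq0 (negPf p0) orbF !mulf_eq0 !subr_eq0.
  by rewrite (negPf st) (negPf sr) !orbF => /eqP.
have Gu : \det G != 0.
  apply/negP => /det0P[z z0]; rewrite mulG => e; case/negP: z0; apply/eqP/rowP.
  elim/ord3_ind; rewrite [RHS]mxE.
  - exact: (kill a b c u v w _ _ _ u0 eu ev ew ab ac e).
  - by apply: (kill b a c v u w _ (z 0 0) (z 0 2%:R));
    rewrite // 1?eq_sym // [_ + z 0 0 *: _]addrC.
  - by apply: (kill c a b w u v _ (z 0 0) (z 0 1));
    rewrite // 1?eq_sym // -addrA addrC.
exists (to_SL G); apply: SL_conj_eq; rewrite to_SLE // -mulmxA GA !mulmxA;
  congr (_ *m _).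
rewrite /SL_scaling diag_mx3 /diag3 !mul_mx3 !(mulr0, mul0r, addr0, add0r).
by rewrite [a * _]mulrC [b * _]mulrC [c * _]mulrC.
Qed.

(** * Trace coordinates *)

Notation "''o_' k" := (@Ordinal 8 k isT) (at level 8, k at level 2,
  format "''o_' k").

Definition eval8 (R : comNzRingType)
    (F : R -> R -> R -> R -> R -> R -> R -> R -> R -> R -> R) (v : 'I_8 -> R) :=
  F 1 1 (v 'o_0) (v 'o_1) (v 'o_2) (v 'o_3) (v 'o_4) (v 'o_5) (v 'o_6) (v 'o_7).

Section RmorphExpr.
Variables (R S : comNzRingType) (phi : {rmorphism R -> S}).

Lemma rmorphD_eq a b a' b' : phi a = a' -> phi b = b' -> phi (a + b) = a' + b'.
Proof. by move=> <- <-; rewrite rmorphD. Qed.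
Lemma rmorphN_eq a a' : phi a = a' -> phi (- a) = - a'.
Proof. by move=> <-; rewrite rmorphN. Qed.
Lemma rmorphM_eq a b a' b' : phi a = a' -> phi b = b' -> phi (a * b) = a' * b'.
Proof. by move=> <- <-; rewrite rmorphM. Qed.
Lemma rmorphX_eq a a' n : phi a = a' -> phi (a ^+ n) = a' ^+ n.
Proof. by move=> <-; rewrite rmorphXn. Qed.

End RmorphExpr.

Ltac push_rmorph :=
  lazymatch goal with
  | |- _ (_%:R) = _ => apply: rmorph_nat
  | |- _ (_ + _) = _ => apply: rmorphD_eq; push_rmorph
  | |- _ (- _) = _ => apply: rmorphN_eq; push_rmorph
  | |- _ (_ ^+ _) = _ => apply: rmorphX_eq; push_rmorph
  | |- _ (_ * _) = _ => apply: rmorphM_eq; push_rmorph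
  | |- _ 1 = _ => apply: rmorph1
  | |- _ => reflexivity
  end.

Section Coordinates.

Lemma rmorph_commP (R S : comNzRingType) (phi : {rmorphism R -> S}) v :
  phi (eval8 (@commP R) v) = eval8 (@commP S) (phi \o v).
Proof.
rewrite /eval8 /commP; push_rmorph.
Qed.

Lemma rmorph_commQ (R S : comNzRingType) (phi : {rmorphism R -> S}) v :
  phi (eval8 (@commQ R) v) = eval8 (@commQ S) (phi \o v).
Proof.
rewrite /eval8 /commQ; push_rmorph.
Qed.

Lemma rmorph_disc (R S : comNzRingType) (phi : {rmorphism R -> S}) x y :
  phi (disc x y) = disc (phi x) (phi y).
Proof.
rewrite /disc; push_rmorph.
Qed.

Variable K : numFieldType.
Local Notation SL3 := (SL K 3).

Definition commtr_sum_poly : {mpoly K[8]} := eval8 (@commP _) (fun i => 'X_i).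
Definition commtr_prod_poly : {mpoly K[8]} := eval8 (@commQ _) (fun i => 'X_i).
Definition discA : {mpoly K[8]} := disc 'X_('o_0) 'X_('o_7).
Definition discB : {mpoly K[8]} := disc 'X_('o_2) 'X_('o_1).

Lemma meval_sum_poly v : commtr_sum_poly.@[v] = eval8 (@commP K) v.
Proof.
transitivity (eval8 (@commP K) (meval v \o (fun i => 'X_i))).
  exact: (rmorph_commP (meval v)).
by congr eval8; apply/funext => i; exact: mevalXU.
Qed.

Lemma meval_prod_poly v : commtr_prod_poly.@[v] = eval8 (@commQ K) v.
Proof.
transitivity (eval8 (@commQ K) (meval v \o (fun i => 'X_i))).
  exact: (rmorph_commQ (meval v)).
by congr eval8; apply/funext => i; exact: mevalXU.
Qed.

Lemma meval_discA v : discA.@[v] = disc (v 'o_0) (v 'o_7).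
Proof. by rewrite -!mevalXU; exact: (rmorph_disc (meval v)). Qed.

Lemma meval_discB v : discB.@[v] = disc (v 'o_2) (v 'o_1).
Proof. by rewrite -!mevalXU; exact: (rmorph_disc (meval v)). Qed.

(** The order is that of the arguments of [commP] after the two determinants. The trace of [A] comes
    last because [muni] singles out the last variable, in which [discA] will be divided out. *)
Definition traces_mx (A B : 'M[K]_3) : 'I_8 -> K := fun i => nth 0
  [:: \tr (\adj A); \tr B; \tr (\adj B); \tr (A *m B); \tr (\adj A *m \adj B);
      \tr (A *m \adj B); \tr (\adj A *m B); \tr A] i.

Definition traces (x : SL3 * SL3) := traces_mx (val x.1) (val x.2).
Definition commtr (x : SL3 * SL3) := tcomm (val x.1) (val x.2).
Definition commtr' (x : SL3 * SL3) := tcomm (val x.2) (val x.1).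

Definition SL_swap (x : SL3 * SL3) := (x.2, x.1).

Lemma SL_tr_subproof (A : SL3) : \det ((val A)^T) == 1.
Proof. by rewrite det_tr SL_det. Qed.

Definition SL_tr (A : SL3) : SL3 := Sub (val A)^T (SL_tr_subproof A).
Definition SL_trpair (x : SL3 * SL3) := (SL_tr x.1, SL_tr x.2).

Lemma ord8_ind (P : 'I_8 -> Prop) : P 'o_0 -> P 'o_1 -> P 'o_2 -> P 'o_3 ->
  P 'o_4 -> P 'o_5 -> P 'o_6 -> P 'o_7 -> forall i, P i.
Proof.
move=> P0 P1 P2 P3 P4 P5 P6 P7 [m lt].
by do 8?[case: m lt => [|m] lt; first by rewrite (bool_irrelevance lt isT)].
Qed.

Lemma tr_conj (g M : 'M[K]_3) : g \in unitmx -> \tr (g *m M *m invmx g) = \tr M.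
Proof. by move=> ug; rewrite mxtrace_mulC mulmxA mulVmx // mul1mx. Qed.

Lemma adj_SL_conj (g A : SL3) :
  \adj (val (SL_conj g A)) = val g *m \adj (val A) *m invmx (val g).
Proof.
rewrite -!SL_inv; have ug := SL_unit g; have uA := SL_unit A.
rewrite -[LHS]mulmx1 -(_ : val (SL_conj g A) *m (val g *m invmx (val A) *m
  invmx (val g)) = 1%:M).
  by rewrite mulKmx // SL_unit.
by rewrite /= !mulmxA !mulmxKV // mulmxK // mulmxV.
Qed.

Lemma conjM (g M N : 'M[K]_3) : g \in unitmx ->
  g *m M *m invmx g *m (g *m N *m invmx g) = g *m (M *m N) *m invmx g.
Proof. by move=> ug; rewrite !mulmxA mulmxKV. Qed.

Lemma traces_act g x : traces (SL_act g x) = traces x.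
Proof.
apply/funext => i; rewrite /traces /traces_mx !adj_SL_conj /= !conjM ?SL_unit
  //.
by rewrite !tr_conj ?SL_unit.
Qed.

Lemma commtr_act g x : commtr (SL_act g x) = commtr x.
Proof.
by rewrite /commtr /tcomm !adj_SL_conj /= !conjM ?SL_unit // tr_conj ?SL_unit.
Qed.

Lemma commtr'_act g x : commtr' (SL_act g x) = commtr' x.
Proof. exact: (commtr_act g (SL_swap x)). Qed.

Lemma traces_trpair x : traces (SL_trpair x) = traces x.
Proof.
apply/funext => i; rewrite /traces /traces_mx /= -!trmx_adj -!trmx_mul
  !mxtrace_tr.
rewrite [\tr (sval x.2 *m sval x.1)]mxtrace_mulC.
rewrite [\tr (sval x.2 *m \adj (sval x.1))]mxtrace_mulC.
rewrite [\tr (\adj (sval x.2) *m sval x.1)]mxtrace_mulC.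
by rewrite [\tr (\adj (sval x.2) *m \adj (sval x.1))]mxtrace_mulC.
Qed.

Lemma commtr_trpair x : commtr (SL_trpair x) = commtr' x.
Proof.
rewrite /commtr /commtr' /tcomm /= -!trmx_adj -!trmx_mul mxtrace_tr.
by rewrite mulmxA mxtrace_mulC !mulmxA.
Qed.

Lemma polyfun_traces i : polynomial_function (fun x => traces x i : K^o).
Proof.
have pA := @polyfun_fst K 3; have pB := @polyfun_snd K 3.
have pA' := polyfun_adj pA; have pB' := polyfun_adj pB.
elim/ord8_ind: i; rewrite /traces /traces_mx /=; apply: polyfun_tr => //;
  exact: polyfun_mulmx.
Qed.

Lemma polyfun_commtr : polynomial_function (commtr : _ -> K^o).
Proof.
have pA := @polyfun_fst K 3; have pB := @polyfun_snd K 3.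
have pA' := polyfun_adj pA; have pB' := polyfun_adj pB.
by apply: polyfun_tr; do 3!apply: polyfun_mulmx => //.
Qed.

Lemma polyfun_commtr' : polynomial_function (commtr' : _ -> K^o).
Proof.
have pA := @polyfun_fst K 3; have pB := @polyfun_snd K 3.
have pA' := polyfun_adj pA; have pB' := polyfun_adj pB.
by apply: polyfun_tr; do 3!apply: polyfun_mulmx => //.
Qed.

Lemma polyfun_traces_mpoly (p : {mpoly K[8]}) :
  polynomial_function (fun x => p.@[traces x] : K^o).
Proof. apply: polyfun_mpoly => i; exact: polyfun_traces. Qed.

End Coordinates.

(** * The diagonal slice: extension of identities, values and independence of the traces *)

Section Slice.
Variable K : numClosedFieldType.
Local Notation SL3 := (SL K 3).

Lemma det_diag3 (R : comNzRingType) (a b c : R) :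
  \det (diag3 a b c) = a * b * c.
Proof. by rewrite det_mx3; ring. Qed.

Lemma adj_diag3 (R : comNzRingType) (a b c : R) :
  \adj (diag3 a b c) = diag3 (b * c) (a * c) (a * b).
Proof. by rewrite adj_mx3 /diag3; congr mx3; ring. Qed.

Lemma discA_eigen (x : SL3 * SL3) a b c :
  a + b + c = \tr (val x.1) -> a * b + a * c + b * c = \tr (\adj (val x.1)) ->
  a * b * c = 1 -> (discA K).@[traces x] = vander a b c ^+ 2.
Proof.
by move=> e1 e2 e3; rewrite meval_discA -disc_vander // e1 e2.
Qed.

Lemma discA_diag (x : SL3 * SL3) a b c : val x.1 = diag3 a b c ->
  (discA K).@[traces x] = vander a b c ^+ 2.
Proof.
move=> ex; apply: discA_eigen; rewrite ?ex ?adj_diag3 ?tr_mx3 //; last first.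
  by rewrite -det_diag3 -ex SL_det.
by rewrite /=; ring.
Qed.

Lemma conj_slice (x : SL3 * SL3) a b c :
  a + b + c = \tr (val x.1) -> a * b + a * c + b * c = \tr (\adj (val x.1)) ->
  a * b * c = 1 -> (discA K).@[traces x] != 0 ->
  exists g, val (SL_act g x).1 = diag3 a b c.
Proof.
move=> e1 e2 e3; rewrite (discA_eigen e1 e2 e3) expf_eq0 /= => v0.
exact: diagonalize.
Qed.

Definition mkSL (M : 'M[K]_3) (M1 : \det M = 1) : SL3 := Sub M (introT eqP M1).

(** For a diagonal matrix and a cyclic permutation matrix the two commutator traces are the cyclic
    sums of a_i / a_(i+1) and of a_(i+1) / a_i. With eigenvalues 1, 2, 1/2 they are 5 and 17/4. *)
Lemma generic_pair : exists x : SL3 * SL3,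
  (discA K).@[traces x] != 0 /\ commtr x != commtr' x.
Proof.
have d1 : \det (diag3 1 2%:R 2%:R^-1 : 'M[K]_3) = 1.
  by rewrite det_diag3 mul1r divff ?pnatr_eq0.
have d2 : \det (mx3 0 1 0 0 0 1 1 0 0 : 'M[K]_3) = 1 by rewrite det_mx3; ring.
have n2 : 2%:R != 0 :> K by rewrite pnatr_eq0.
have n3 : 3%:R != 0 :> K by rewrite pnatr_eq0.
exists (mkSL d1, mkSL d2); split.
  rewrite (@discA_diag _ 1 2%:R 2%:R^-1) // expf_eq0 /=.
  have -> : vander 1 2%:R 2%:R^-1 = - 3%:R / 4%:R :> K by rewrite /vander;
    field.
  by rewrite mulf_neq0 ?invr_eq0 ?oppr_eq0 ?pnatr_eq0.
rewrite /commtr /commtr' /tcomm /= adj_diag3 adj_mx3 /diag3 !mul_mx3 !tr_mx3.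
rewrite -subr_eq0 (_ : _ - _ = 3%:R / 4%:R) ?mulf_neq0 ?invr_eq0 ?pnatr_eq0 //.
by field.
Qed.

(** Where [discA] is nonzero the pair can be conjugated into the slice, so [discA] times F - G
    vanishes everywhere; [polyfun_domain] then cancels [discA]. *)
Lemma polyfun_eq_slice (F G : SL3 * SL3 -> K^o) :
  polynomial_function F -> polynomial_function G ->
  invariant_function F -> invariant_function G ->
  (forall x a b c, val x.1 = diag3 a b c -> F x = G x) -> forall x, F x = G x.
Proof.
move=> pF pG iF iG FG x; have [x1 [x1d _]] := generic_pair.
apply/eqP; rewrite -subr_eq0; apply/eqP.
apply: (@polyfun_domain _ _ (fun x => (discA K).@[traces x]) (fun x =>
  F x - G x) x1) => //.
- exact: polyfun_traces_mpoly.
- by apply: polyfunD => //; apply: polyfunN.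
move=> y; have [->|y0] := eqVneq (discA K).@[traces y] 0;
  first by rewrite mul0r.
have [a [b [c [e1 e2 e3]]]] := cubic_roots (\tr (val y.1)) (\tr (\adj (val
  y.1))).
have [g /FG] := conj_slice e1 e2 e3 y0.
by rewrite iF iG => ->; rewrite subrr mulr0.
Qed.

Lemma comm8_traces F (x : SL3 * SL3) :
  eval8 F (traces x) = on_traces F (val x.1) (val x.2).
Proof. by rewrite /on_traces !SL_det. Qed.

Lemma commtr_sum (x : SL3 * SL3) :
  commtr x + commtr' x = (commtr_sum_poly K).@[traces x].
Proof.
move: x; apply: polyfun_eq_slice.
- by apply: polyfunD; [exact: polyfun_commtr | exact: polyfun_commtr'].
- exact: polyfun_traces_mpoly.
- by move=> g x; rewrite commtr_act commtr'_act.
- by move=> g x; rewrite traces_act.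
- move=> x a b c ex; rewrite meval_sum_poly comm8_traces /commtr /commtr' ex.
  exact: tcomm_diag_sum.
Qed.

Lemma commtr_prod (x : SL3 * SL3) :
  commtr x * commtr' x = (commtr_prod_poly K).@[traces x].
Proof.
move: x; apply: polyfun_eq_slice.
- by apply: polyfunM; [exact: polyfun_commtr | exact: polyfun_commtr'].
- exact: polyfun_traces_mpoly.
- by move=> g x; rewrite commtr_act commtr'_act.
- by move=> g x; rewrite traces_act.
- move=> x a b c ex; rewrite meval_prod_poly comm8_traces /commtr /commtr' ex.
  exact: tcomm_diag_prod.
Qed.

(** Since bc = a^2 - (a+b+c) a + (ab+ac+bc), this is a Vandermonde system. In t2 + a t1 - a (b+c) t0
    the coefficients of [b2] and [b3] are zero and that of [b1] is (a-b)(a-c). *)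
Lemma lagrange3 (a b c t0 t1 t2 : K) : vander a b c != 0 ->
  exists b1 b2 b3, [/\ b1 + b2 + b3 = t0, a * b1 + b * b2 + c * b3 = t1 &
    b * c * b1 + a * c * b2 + a * b * b3 = t2].
Proof.
rewrite !mulf_eq0 !negb_or => /andP[/andP[ab ac] bc].
exists ((t2 + a * t1 - a * (b + c) * t0) / ((a - b) * (a - c))).
exists ((t2 + b * t1 - b * (a + c) * t0) / ((b - a) * (b - c))).
exists ((t2 + c * t1 - c * (a + b) * t0) / ((c - a) * (c - b))).
have ba : b - a != 0 by rewrite -opprB oppr_eq0.
have ca : c - a != 0 by rewrite -opprB oppr_eq0.
have cb : c - b != 0 by rewrite -opprB oppr_eq0.
by split; field; rewrite ?ab ?ac ?bc ?ba ?ca ?cb.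
Qed.

(** The two products along 3-cycles have sum [s] and product p1 p2 p3, so they are the roots c1, c2
    of a quadratic. If one of them is nonzero, it serves to solve for the entries; if both are zero,
    then s = 0 and some p_i is zero. *)
Lemma cycle_entries (p1 p2 p3 s : K) : exists b12 b13 b21 b23 b31 b32,
  [/\ b12 * b21 = p3, b13 * b31 = p2, b23 * b32 = p1 &
      b12 * b23 * b31 + b13 * b32 * b21 = s].
Proof.
pose r := sqrtC (s ^+ 2 - 4%:R * (p1 * p2 * p3)).
have n2 : 2%:R != 0 :> K by rewrite pnatr_eq0.
have [c1 [c2 [ec ep]]] : exists c1 c2, c1 + c2 = s /\ c1 * c2 = p1 * p2 * p3.
  exists ((s + r) / 2%:R), ((s - r) / 2%:R); split; first by field.
  rewrite (_ : _ * _ = (s ^+ 2 - r ^+ 2) / 4%:R); last by field.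
  by rewrite sqrtCK; field.
have [c10|c10] := eqVneq c1 0; last first.
  exists 1, (p2 / c1), p3, 1, c1, p1; split; rewrite ?mul1r //.
    by rewrite divfK.
  rewrite -ec; congr (_ + _); apply: (mulfI c10).
  by rewrite ep; field.
have [c20|c20] := eqVneq c2 0; last first.
  exists p3, c2, 1, p1, (p2 / c2), 1; split; rewrite ?mulr1 //.
    by rewrite mulrC divfK.
  rewrite -ec; congr (_ + _); apply: (mulIf c20).
  by rewrite ep; field.
move: ep; rewrite -ec c10 c20 mul0r addr0 => /esym/eqP.
rewrite !mulf_eq0 => /orP[/orP[]|] /eqP ->.
- by exists 1, p2, p3, 0, 1, 0; split; ring.
- by exists 1, 0, p3, 1, 0, p1; split; ring.
- by exists 0, p2, 0, 1, 1, p1; split; ring.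
Qed.

Lemma traces_onto (v : 'I_8 -> K) : (discA K).@[v] != 0 ->
  exists x, traces x = v.
Proof.
have [a [b [c [e1 e2 e3]]]] := cubic_roots (v 'o_7) (v 'o_0).
rewrite meval_discA -e1 -e2 disc_vander // expf_eq0 /= => V0.
have [b1 [b2 [b3 [eb1 eb2 eb3]]]] := lagrange3 (v 'o_1) (v 'o_3) (v 'o_6) V0.
have [m1 [m2 [m3 [em1 em2 em3]]]] := lagrange3 (v 'o_2) (v 'o_5) (v 'o_4) V0.
(* The principal minors m_i, that is the diagonal of the adjugate, fix the products of opposite
   off-diagonal entries; the sum of the two 3-cycles is then dictated by determinant 1. *)
pose p1 := b2 * b3 - m1; pose p2 := b1 * b3 - m2; pose p3 := b1 * b2 - m3.
have [b12 [b13 [b21 [b23 [b31 [b32 [f3 f2 f1 fs]]]]]]] :=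
  cycle_entries p1 p2 p3 (1 - b1 * b2 * b3 + b1 * p1 + b2 * p2 + b3 * p3).
pose B := mx3 b1 b12 b13 b21 b2 b23 b31 b32 b3.
have dA : \det (diag3 a b c) = 1 by rewrite det_diag3.
have dB : \det B = 1.
  rewrite det_mx3; transitivity (b1 * b2 * b3 - b1 * (b23 * b32) - b2 * (b13 *
    b31)
     - b3 * (b12 * b21) + (b12 * b23 * b31 + b13 * b32 * b21)); first by ring.
  by rewrite f1 f2 f3 fs; ring.
exists (mkSL dA, mkSL dB); apply/funext.
have g1 : b2 * b3 - b23 * b32 = m1 by rewrite f1 /p1; ring.
have g2 : b1 * b3 - b13 * b31 = m2 by rewrite f2 /p2; ring.
have g3 : b1 * b2 - b12 * b21 = m3 by rewrite f3 /p3; ring.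
elim/ord8_ind; rewrite /traces /traces_mx /= ?adj_diag3 /B ?adj_mx3 /diag3
  ?mul_mx3 ?tr_mx3 ?g1 ?g2 ?g3.
- by rewrite -e2; ring.
- by [].
- by [].
- by rewrite -eb2; ring.
- by rewrite -em3; ring.
- by rewrite -em2; ring.
- by rewrite -eb3; ring.
- by [].
Qed.

Lemma traces_indep (r : {mpoly K[8]}) : (forall x, r.@[traces x] = 0) -> r = 0.
Proof.
move=> r0; have : discA K * r = 0.
  apply: mpoly_fun_eq0 => v; rewrite mevalM.
  have [->|/traces_onto[x <-]] := eqVneq (discA K).@[v] 0;
    first by rewrite mul0r.
  by rewrite r0 mulr0.
move=> /eqP; rewrite mulf_eq0 => /orP[/eqP d0|/eqP //].
by have [x []] := generic_pair; rewrite d0 meval0 eqxx.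
Qed.

Lemma traces_commtr_indep (r0 r1 : {mpoly K[8]}) :
  (forall x, r0.@[traces x] + r1.@[traces x] * commtr x = 0) ->
    r0 = 0 /\ r1 = 0.
Proof.
move=> r00; have r10 : r1 = 0.
  apply: traces_indep; have [x1 [_ x1c]] := generic_pair.
  apply: (@polyfun_domain _ _ (fun x => commtr x - commtr' x) _ x1) => //.
  - by apply: polyfunD (polyfunN _);
    [exact: polyfun_commtr | exact: polyfun_commtr'].
  - exact: polyfun_traces_mpoly.
  - move=> x; have := r00 (SL_trpair x); have := r00 x.
    rewrite traces_trpair commtr_trpair => e e'.
    transitivity ((r0.@[traces x] + r1.@[traces x] * commtr x) -
      (r0.@[traces x] + r1.@[traces x] * commtr' x));
        last by rewrite e e' subrr.
    by ring.
  - by rewrite subr_eq0.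
split=> //; apply: traces_indep => x; have := r00 x.
by rewrite r10 meval0 mul0r addr0.
Qed.

End Slice.

(** * Torus invariants *)

(** The left side of the hypothesis is a Laurent polynomial in [s] that is constant for nonzero [s],
    so its terms of weight zero already sum to [c]. The filter [P] allows a second extraction from
    the outcome of a first. *)
Lemma weight_zero_part (K : numFieldType) (n : nat) (u d : 'I_n -> nat)
    (r : seq 'X_{1..n}) (P : pred 'X_{1..n}) (al : 'X_{1..n} -> K)
    (v : 'I_n -> K) (c : K) :
  (forall s, s != 0 ->
    \sum_(m <- r | P m) al m * \prod_k (s ^+ u k / s ^+ d k *
      v k) ^+ m k = c) ->
  \sum_(m <- r | P m && (\sum_k u k * m k == \sum_k d k * m k)%N)
    al m * \prod_k v k ^+ m k = c.
Proof.
move=> Hs; pose W (w : 'I_n -> nat) (m : 'X_{1..n}) := (\sum_k w k * m k)%N.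
(* [D] bounds all negative exponents, so multiplication by s^D clears the denominators, and weight
   zero becomes the coefficient of degree [D]. *)
pose D := (\sum_(m <- r) W d m)%N.
have WD m : m \in r -> (W d m <= D)%N.
  by move=> mr; rewrite /D (big_rem m) //= leq_addr.
pose q : {poly K} := \sum_(m <- r | P m)
  (al m * \prod_k v k ^+ m k) *: 'X^(W u m + (D - W d m)) - c *: 'X^D.
(* The hypothesis says nothing at s = 0, where the extra factor vanishes. *)
have q0 : 'X * q = 0.
  apply: poly_fun_eq0 => s; rewrite hornerM hornerX.
  have [->|s0] := eqVneq s 0; first by rewrite mul0r.
  rewrite hornerD hornerN hornerZ hornerXn -{1}(Hs s s0) horner_sum big_distrl
    /=.
  apply/eqP; rewrite mulf_eq0; apply/orP; right; rewrite subr_eq0; apply/eqP.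
  rewrite big_seq_cond [RHS]big_seq_cond; apply: eq_bigr => m /andP[mr _].
  rewrite hornerZ hornerXn -!mulrA; congr (_ * _).
  have -> : \prod_k (s ^+ u k / s ^+ d k * v k) ^+ m k =
      s ^+ W u m / s ^+ W d m * \prod_k v k ^+ m k.
    rewrite !expr_sum -prodfV -!big_split /=; apply: eq_bigr => k _.
    by rewrite exprMn exprMn exprVn !exprM.
  have eD : s ^+ D = s ^+ (D - W d m) *
    s ^+ W d m by rewrite -exprD subnK // WD.
  by rewrite exprD eD; field; rewrite expf_neq0.
have /(congr1 (fun p : {poly K} => p`_D)) : q = 0.
  by apply/eqP; move/eqP: q0; rewrite mulf_eq0 polyX_eq0.
rewrite coef0 coefB coefZ coefXn eqxx mulr1 coef_sum => /eqP.
rewrite subr_eq0 => /eqP <-; rewrite big_mkcondr /=.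
rewrite big_seq_cond [RHS]big_seq_cond; apply: eq_bigr => m /andP[mr _].
rewrite coefZ coefXn -/(W u m) -/(W d m); have := WD m mr.
case: eqP => [-> le|ne le]; first by rewrite subnKC // eqxx mulr1.
by case: eqP => [|_]; rewrite ?mulr0 //; lia.
Qed.

Lemma big_entries (R : Type) (idx : R) (op : Monoid.com_law idx) n
    (F : 'I_(n * n + n * n) -> R) :
  \big[op/idx]_k F k =
  op (\big[op/idx]_i \big[op/idx]_j F (lshift _ (mxvec_index i j)))
     (\big[op/idx]_i \big[op/idx]_j F (rshift _ (mxvec_index i j))).
Proof.
rewrite big_split_ord; congr (op _ _).
  rewrite pair_big /= (reindex _ (curry_mxvec_bij n n)) /=.
  by apply: eq_bigr => -[].
rewrite pair_big /= (reindex _ (curry_mxvec_bij n n)) /=.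
by apply: eq_bigr => -[].
Qed.

Lemma big_ord3 (R : Type) (idx : R) (op : Monoid.law idx) (F : 'I_3 -> R) :
  \big[op/idx]_i F i = op (op (F 0) (F 1)) (F 2%:R).
Proof.
rewrite !big_ord_recl big_ord0 Monoid.mulm1 Monoid.mulmA.
by congr (op (op _ (F _)) (F _)); exact: val_inj.
Qed.

Section TorusInvariants.
Variable K : numFieldType.
Local Notation SL3 := (SL K 3).

Definition row_weight (w : 'I_3 -> nat) : 'I_(3 * 3 + 3 * 3) -> nat :=
  row_mx (mxvec (\matrix_(i, j) w i)) (mxvec (\matrix_(i, j) w i)) 0.
Definition col_weight (w : 'I_3 -> nat) : 'I_(3 * 3 + 3 * 3) -> nat :=
  row_mx (mxvec (\matrix_(i, j) w j)) (mxvec (\matrix_(i, j) w j)) 0.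

Lemma row_weightl w i j : row_weight w (lshift _ (mxvec_index i j)) = w i.
Proof. by rewrite /row_weight row_mxEl mxvecE mxE. Qed.
Lemma row_weightr w i j : row_weight w (rshift _ (mxvec_index i j)) = w i.
Proof. by rewrite /row_weight row_mxEr mxvecE mxE. Qed.
Lemma col_weightl w i j : col_weight w (lshift _ (mxvec_index i j)) = w j.
Proof. by rewrite /col_weight row_mxEl mxvecE mxE. Qed.
Lemma col_weightr w i j : col_weight w (rshift _ (mxvec_index i j)) = w j.
Proof. by rewrite /col_weight row_mxEr mxvecE mxE. Qed.

(** The conjugating matrix is diagonal with entries s^(w_i - 1): total weight 3 gives it determinant
    1, and the common factor 1/s disappears in the conjugation. *)
Lemma torus_act (w : 'I_3 -> nat) (s : K) (x : SL3 * SL3) : s != 0 ->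
  (\sum_i w i = 3)%N ->
  exists g, forall k,
    entries (SL_act g x) k = s ^+ row_weight w k / s ^+ col_weight w k *
      entries x k.
Proof.
move=> s0 w3; pose D : 'M[K]_3 := diag_mx (\row_i (s ^+ w i / s)).
have D1 : \det D = 1.
  rewrite det_diag (eq_bigr (fun i => s ^+ w i * s^-1)) => [|i _];
    last by rewrite mxE.
  by rewrite big_split /= -expr_sum w3 prodr_const card_ord exprVn mulfV //
    expf_neq0.
pose E : 'M[K]_3 := diag_mx (\row_i (s / s ^+ w i)).
have DE : D *m E = 1%:M.
  rewrite mulmx_diag -diag_const_mx; congr diag_mx; apply/rowP => i;
    rewrite !mxE.
  by field; rewrite s0 expf_neq0.
have inv : invmx D = E.
  by rewrite -[LHS]mulmx1 -DE mulKmx // unitmxE D1 unitr1.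
have conj (M : 'M[K]_3) i j : (D *m M *m invmx D) i j = s ^+ w i / s ^+ w j *
  M i j.
  rewrite inv mul_mx_diag mul_diag_mx !mxE.
  by field; rewrite s0 !expf_neq0.
exists (Sub D (introT eqP D1)); elim/entries_case => i j.
  by rewrite row_weightl col_weightl !entriesl /= conj.
by rewrite row_weightr col_weightr !entriesr /= conj.
Qed.

Definition balanced (w : 'I_3 -> nat) (m : 'X_{1..3 * 3 + 3 * 3}) :=
  (\sum_k row_weight w k * m k == \sum_k col_weight w k * m k)%N.

(* Exponents, shifted by 1, of diag(s, 1, s^-1) and diag(1, s, s^-1). *)
Definition w210 : 'I_3 -> nat := nth 0%N [:: 2; 1; 0]%N.
Definition w120 : 'I_3 -> nat := nth 0%N [:: 1; 2; 0]%N.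

(** The two one-parameter subgroups generate the diagonal torus. The first extraction holds at every
    point, so the remaining sum is again invariant and the second subgroup can act on it. *)
Lemma invariant_balanced (F : SL3 * SL3 -> K^o) (p : {mpoly K[3 * 3 + 3 * 3]}) :
  (forall x, F x = p.@[entries x]) -> invariant_function F -> forall x,
  F x = \sum_(m <- msupp p | balanced w210 m && balanced w120 m)
     p@_m * \prod_k entries x k ^+ m k.
Proof.
move=> Fp iF x; apply/esym.
have step1 y : \sum_(m <- msupp p | true && balanced w210 m)
     p@_m * \prod_k entries y k ^+ m k = F y.
  apply: weight_zero_part => s s0.
  have [|g eg] := @torus_act w210 s y s0; first by rewrite big_ord3.
  by rewrite -(iF g y) Fp mevalE; apply: eq_bigr => m _;
    under [in RHS]eq_bigr do rewrite eg.
apply: weight_zero_part => s s0.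
have [|g eg] := @torus_act w120 s x s0; first by rewrite big_ord3.
rewrite -(iF g x) -step1; apply: eq_big => // m _.
by under [in RHS]eq_bigr do rewrite eg.
Qed.

End TorusInvariants.

(** * Invariants on the diagonal slice *)

Section DiagonalIdentities.
Variable R : comNzRingType.

Lemma diag_entries (a b c : R) (M : 'M[R]_3) :
  let t0 := \tr M in let t1 := \tr (diag3 a b c *m M) in
  let t2 := \tr (diag3 (b * c) (a * c) (a * b) *m M) in
  [/\ M 0 0 * vander a b c = (t2 + a * t1 - a * (b + c) * t0) * (b - c),
      M 1 1 * vander a b c = (t2 + b * t1 - b * (a + c) * t0) * (c - a) &
      M 2%:R 2%:R * vander a b c = (t2 + c * t1 - c * (a + b) * t0) * (a - b)].
Proof.
elim/mx3P: M => m1 m2 m3 m4 m5 m6 m7 m8 m9.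
by rewrite /diag3 /vander !mul_mx3 !tr_mx3 !mxE; split=> /=; ring.
Qed.

(** This is where the ninth coordinate enters: the determinant gives only the sum of the two
    3-cycles, and the commutator traces give their difference. *)
Lemma tcomm_diag_sub (a b c : R) (M : 'M[R]_3) :
  (M 0 1 * M 1 2%:R * M 2%:R 0 - M 0 2%:R * M 2%:R 1 * M 1 0) * vander a b c =
  tcomm M (diag3 a b c) - tcomm (diag3 a b c) M.
Proof.
elim/mx3P: M => m1 m2 m3 m4 m5 m6 m7 m8 m9.
rewrite /tcomm /diag3 /vander !adj_mx3 !mul_mx3 !tr_mx3 !mxE /=; ring.
Qed.

Lemma principal_minors (M : 'M[R]_3) :
  [/\ M 1 2%:R * M 2%:R 1 = M 1 1 * M 2%:R 2%:R - \adj M 0 0,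
      M 0 2%:R * M 2%:R 0 = M 0 0 * M 2%:R 2%:R - \adj M 1 1 &
      M 0 1 * M 1 0 = M 0 0 * M 1 1 - \adj M 2%:R 2%:R].
Proof.
elim/mx3P: M => m1 m2 m3 m4 m5 m6 m7 m8 m9.
by rewrite adj_mx3 !mxE; split=> /=; ring.
Qed.

Lemma det_cycles (M : 'M[R]_3) :
  M 0 1 * M 1 2%:R * M 2%:R 0 + M 0 2%:R * M 2%:R 1 * M 1 0 =
  \det M - M 0 0 * M 1 1 * M 2%:R 2%:R + M 0 0 * (M 1 2%:R * M 2%:R 1)
  + M 1 1 * (M 0 2%:R * M 2%:R 0) + M 2%:R 2%:R * (M 0 1 * M 1 0).
Proof.
elim/mx3P: M => m1 m2 m3 m4 m5 m6 m7 m8 m9.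
by rewrite det_mx3 !mxE /=; ring.
Qed.

End DiagonalIdentities.

Section Localization.
Variable K : numClosedFieldType.
Local Notation SL3 := (SL K 3).
Implicit Types (x : SL3 * SL3) (phi psi : SL3 * SL3 -> K).

Definition traces9 x : 'I_9 -> K :=
  fun i => oapp (traces x) (commtr x) (insub (val i)).

Lemma traces9_widen x : traces9 x \o widen_ord (leqnSn 8) = traces x.
Proof.
by apply/funext => i; rewrite /traces9 /= insubT.
Qed.

Lemma traces9_max x : traces9 x ord_max = commtr x.
Proof. by rewrite /traces9 insubF. Qed.

Definition eig x i := val x.1 i i.
Definition is_slice x := val x.1 = diag3 (eig x 0) (eig x 1) (eig x 2%:R).
Definition slice_vander x := vander (eig x 0) (eig x 1) (eig x 2%:R).
Definition slice_coord x : 'I_(3 + 9) -> K :=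
  fun k => match fintype.split k with
  | inl i => eig x i | inr j => traces9 x j end.

(* On the slice of the pairs whose first matrix is diagonal, [phi] is a
   polynomial in the eigenvalues and the traces, up to a power of the
   Vandermonde determinant of the eigenvalues. *)
Definition localized phi :=
  exists N (h : {mpoly K[3 + 9]}), forall x, is_slice x ->
  phi x * slice_vander x ^+ N = h.@[slice_coord x].

Lemma meval_slice_vander x :
  (vander 'X_(lshift 9 0) 'X_(lshift 9 1) 'X_(lshift 9 2%:R) :
    {mpoly K[3 + 9]}).@[slice_coord x]
  = slice_vander x.
Proof.
rewrite /vander !(mevalM, mevalB, mevalXU) /slice_coord.
by rewrite !(unsplitK (inl _ : 'I_3 + 'I_9)).
Qed.

Lemma loc_le phi N M (h : {mpoly K[3 + 9]}) : (N <= M)%N ->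
  (forall x, is_slice x -> phi x * slice_vander x ^+ N = h.@[slice_coord x]) ->
  exists h' : {mpoly K[3 + 9]}, forall x, is_slice x ->
    phi x * slice_vander x ^+ M = h'.@[slice_coord x].
Proof.
move=> NM hE; eexists (h * vander 'X_(lshift 9 0) 'X_(lshift 9 1) 'X_(lshift 9
  2%:R) ^+ (M - N)) => x sx.
rewrite mevalM rmorphXn /= meval_slice_vander -hE // -mulrA -exprD subnKC //.
Qed.

Lemma loc_poly (h : {mpoly K[3 + 9]}) : localized (fun x => h.@[slice_coord x]).
Proof. by exists 0%N, h => x _; rewrite mulr1. Qed.

Lemma loc_div k phi psi : localized psi ->
  (forall x, is_slice x -> phi x * slice_vander x ^+ k = psi x) ->
    localized phi.
Proof.
move=> [N [h hE]] e; exists (k + N)%N, h => x sx.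
by rewrite exprD mulrA e // hE.
Qed.

Lemma loc_ext phi psi : localized psi -> (forall x, is_slice x ->
  phi x = psi x) -> localized phi.
Proof. by move=> lp e; apply: (@loc_div 0 _ _ lp) => x sx; rewrite mulr1 e. Qed.

Lemma loc_cst c : localized (fun=> c).
Proof. by apply: loc_ext (loc_poly c%:MP) _ => x _; rewrite mevalC. Qed.

Lemma loc_eig i : localized (eig^~ i).
Proof.
apply: loc_ext (loc_poly 'X_(lshift 9 i)) _ => x _;
  rewrite mevalXU /slice_coord.
by rewrite (unsplitK (inl _ : 'I_3 + 'I_9)).
Qed.

Lemma loc_traces9 j : localized (traces9^~ j).
Proof.
apply: loc_ext (loc_poly 'X_(rshift 3 j)) _ => x _;
  rewrite mevalXU /slice_coord.
by rewrite (unsplitK (inr _ : 'I_3 + 'I_9)).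
Qed.

Lemma loc_traces i : localized (fun x => traces x i).
Proof.
apply: loc_ext (loc_traces9 (widen_ord (leqnSn 8) i)) _ => x _.
by rewrite -[RHS]/((traces9 x \o _) i) traces9_widen.
Qed.

Lemma loc_commtr : localized (@commtr K).
Proof. by apply: loc_ext (loc_traces9 ord_max) _ => x _;
  rewrite traces9_max. Qed.

Lemma locD phi psi : localized phi -> localized psi ->
  localized (fun x => phi x + psi x).
Proof.
move=> [N [h hE]] [M [g gE]]; exists (N + M)%N.
have [h' h'E] := loc_le (leq_addr M N) hE;
  have [g' g'E] := loc_le (leq_addl N M) gE.
by exists (h' + g') => x sx; rewrite mulrDl h'E // g'E // mevalD.
Qed.

Lemma locM phi psi : localized phi -> localized psi ->
  localized (fun x => phi x * psi x).
Proof.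
move=> [N [h hE]] [M [g gE]]; exists (N + M)%N, (h * g) => x sx.
by rewrite exprD mevalM -hE // -gE //; ring.
Qed.

Lemma locN phi : localized phi -> localized (fun x => - phi x).
Proof.
move=> lp; apply: loc_ext (locM (loc_cst (-1)) lp) _ => x _.
by rewrite mulN1r.
Qed.

Lemma locB phi psi : localized phi -> localized psi ->
  localized (fun x => phi x - psi x).
Proof. by move=> lp lq; apply: locD lp (locN lq). Qed.

Lemma locX phi k : localized phi -> localized (fun x => phi x ^+ k).
Proof.
move=> lp; elim: k => [|k IHk]; first exact: loc_cst.
by apply: loc_ext (locM lp IHk) _ => x _; rewrite exprS.
Qed.

Lemma loc_mpoly n (p : {mpoly K[n]}) (e : SL3 * SL3 -> 'I_n -> K) :
  (forall i, localized (e^~ i)) -> localized (fun x => p.@[e x]).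
Proof.
move=> le; elim/mpoly_alg_ind: p => [c|i|p q IHp IHq|p q IHp IHq].
- by apply: loc_ext (loc_cst c) _ => x _; rewrite mevalC.
- by apply: loc_ext (le i) _ => x _; rewrite mevalXU.
- by apply: loc_ext (locD IHp IHq) _ => x _; rewrite mevalD.
- by apply: loc_ext (locM IHp IHq) _ => x _; rewrite mevalM.
Qed.

Lemma loc_sum (I : Type) (r : seq I) (P : pred I) (phi : I -> SL3 * SL3 -> K) :
  (forall i, P i -> localized (phi i)) ->
    localized (fun x => \sum_(i <- r | P i) phi i x).
Proof.
move=> lp; elim: r => [|i r IHr].
  by apply: loc_ext (loc_cst 0) _ => x _; rewrite big_nil.
case Pi: (P i); last by apply: loc_ext IHr _ => x _; rewrite big_cons Pi.
by apply: loc_ext (locD (lp i Pi) IHr) _ => x _; rewrite big_cons Pi.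
Qed.

Lemma loc_prod (I : Type) (r : seq I) (phi : I -> SL3 * SL3 -> K) :
  (forall i, localized (phi i)) -> localized (fun x => \prod_(i <- r) phi i x).
Proof.
move=> lp; elim: r => [|i r IHr].
  by apply: loc_ext (loc_cst 1) _ => x _; rewrite big_nil.
by apply: loc_ext (locM (lp i) IHr) _ => x _; rewrite big_cons.
Qed.

Lemma slice_tr (x : SL3 * SL3) M : is_slice x ->
  \tr (diag3 (eig x 0) (eig x 1) (eig x 2%:R) *m M) = \tr (val x.1 *m M) /\
  \tr (diag3 (eig x 1 * eig x 2%:R) (eig x 0 * eig x 2%:R) (eig x 0 *
    eig x 1) *m M)
    = \tr (\adj (val x.1) *m M).
Proof. by move=> sx; rewrite -adj_diag3 -sx. Qed.

Lemma loc_diag_entry (M : SL3 * SL3 -> 'M[K]_3) :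
  localized (fun x => \tr (M x)) -> localized (fun x => \tr (val x.1 *m M x)) ->
  localized (fun x => \tr (\adj (val x.1) *m M x)) ->
    forall i, localized (fun x => M x i i).
Proof.
move=> l0 l1 l2; have E := loc_eig.
have num i j k : localized (fun x => (\tr (\adj (val x.1) *m M x) +
    eig x i * \tr (val x.1 *m M x) - eig x i * (eig x j + eig x k) * \tr (M x))
    * (eig x j - eig x k)).
  by apply: locM; [apply: locB; [apply: locD => //|]|apply: locB];
    repeat first [apply: locM | apply: locD | done].
elim/ord3_ind.
- apply: (loc_div (k := 1) (num 0 1 2%:R)) => x sx; rewrite expr1 /slice_vander.
  by have [-> _ _] := diag_entries (eig x 0) (eig x 1) (eig x 2%:R) (M x);
    have [-> ->] := slice_tr (M x) sx.
- apply: (loc_div (k := 1) (num 1 2%:R 0)) => x sx; rewrite expr1 /slice_vander.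
  by have [_ -> _] := diag_entries (eig x 0) (eig x 1) (eig x 2%:R) (M x);
    have [-> ->] := slice_tr (M x) sx; rewrite [eig x 0 + _]addrC.
- apply: (loc_div (k := 1) (num 2%:R 0 1)) => x sx; rewrite expr1 /slice_vander.
  by have [_ _ ->] := diag_entries (eig x 0) (eig x 1) (eig x 2%:R) (M x);
    have [-> ->] := slice_tr (M x) sx.
Qed.

Lemma loc_diag i : localized (fun x => val x.2 i i).
Proof.
apply: loc_diag_entry; [exact: (loc_traces 'o_1)|exact: (loc_traces
  'o_3)|exact: (loc_traces 'o_6)].
Qed.

Lemma loc_minor i : localized (fun x => \adj (val x.2) i i).
Proof.
apply: (@loc_diag_entry (fun x => \adj (val x.2)));
 [exact: (loc_traces 'o_2)|exact: (loc_traces 'o_5)|exact: (loc_traces 'o_4)].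
Qed.

Lemma loc_2cycles : [/\ localized (fun x => val x.2 1 2%:R * val x.2 2%:R 1),
  localized (fun x => val x.2 0 2%:R * val x.2 2%:R 0) &
  localized (fun x => val x.2 0 1 * val x.2 1 0)].
Proof.
have D := loc_diag; have M := loc_minor.
split.
- apply: loc_ext (locB (locM (D 1) (D 2%:R)) (M 0)) _ => x _.
  by case: (principal_minors (val x.2)).
- apply: loc_ext (locB (locM (D 0) (D 2%:R)) (M 1)) _ => x _.
  by case: (principal_minors (val x.2)).
- apply: loc_ext (locB (locM (D 0) (D 1)) (M 2%:R)) _ => x _.
  by case: (principal_minors (val x.2)).
Qed.

(** Each 3-cycle is half the sum or difference of two localized functions: the sum comes from
    determinant 1 and the difference from the commutator traces. *)
Lemma loc_3cycles :
  localized (fun x => val x.2 0 1 * val x.2 1 2%:R * val x.2 2%:R 0) /\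
  localized (fun x => val x.2 0 2%:R * val x.2 2%:R 1 * val x.2 1 0).
Proof.
have D := loc_diag; have [p0 p1 p2] := loc_2cycles.
pose c1 x := val x.2 0 1 * val x.2 1 2%:R * val x.2 2%:R 0.
pose c2 x := val x.2 0 2%:R * val x.2 2%:R 1 * val x.2 1 0.
have sum : localized (fun x => c1 x + c2 x).
  apply: (@loc_ext _ (fun x => 1 - val x.2 0 0 * val x.2 1 1 * val x.2 2%:R 2%:R
     + val x.2 0 0 * (val x.2 1 2%:R * val x.2 2%:R 1)
     + val x.2 1 1 * (val x.2 0 2%:R * val x.2 2%:R 0)
     + val x.2 2%:R 2%:R * (val x.2 0 1 * val x.2 1 0))); last first.
    by move=> x _; rewrite /c1 /c2 det_cycles SL_det.
  repeat first [exact: D | exact: loc_cst | exact: p0 | exact: p1 | exact: p2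
   | apply: locB | apply: locD | apply: locM].
have dif : localized (fun x => c1 x - c2 x).
  (* The second commutator trace is not among the nine coordinates; c' - c is written as P(t) -
     2c. *)
  apply: (@loc_div 1 _ (fun x => (commtr_sum_poly K).@[traces x] - 2%:R *
    commtr x)).
    by apply: locB (locM (loc_cst _) loc_commtr); apply: loc_mpoly loc_traces.
  move=> x sx; rewrite expr1 /c1 /c2 /slice_vander tcomm_diag_sub -sx
    -commtr_sum.
  by rewrite /commtr /commtr'; ring.
have h2 : 2%:R != 0 :> K by rewrite pnatr_eq0.
split.
- apply: loc_ext (locM (loc_cst 2%:R^-1) (locD sum dif)) _ => x _.
  by rewrite -/(c1 x); field.
- apply: loc_ext (locM (loc_cst 2%:R^-1) (locB sum dif)) _ => x _.
  by rewrite -/(c2 x); field.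
Qed.

End Localization.

Definition mexpl (m : 'X_{1..3 * 3 + 3 * 3}) (i j : 'I_3) : nat :=
  m (lshift _ (mxvec_index i j)).
Definition mexpr (m : 'X_{1..3 * 3 + 3 * 3}) (i j : 'I_3) : nat :=
  m (rshift _ (mxvec_index i j)).

Lemma balancedE w m : balanced w m =
  (\sum_i \sum_j w i * mexpl m i j + \sum_i \sum_j w i * mexpr m i j ==
   \sum_i \sum_j w j * mexpl m i j + \sum_i \sum_j w j * mexpr m i j)%N.
Proof.
rewrite /balanced !big_entries; congr ((_ + _ == _ + _)%N);
  apply: eq_bigr => i _; apply: eq_bigr => j _;
  by rewrite ?row_weightl ?row_weightr ?col_weightl ?col_weightr.
Qed.

(* A balanced exponent matrix is a sum of cycles: [p], [q], [r] count the
   2-cycles, [s] and [t] the two 3-cycles. *)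
Lemma balanced_cycles m : (forall i j, i != j -> mexpl m i j = 0%N) ->
  balanced w210 m -> balanced w120 m ->
  exists p q r s t, [/\ mexpr m 0 1 = (p + s)%N /\ mexpr m 1 0 = (p + t)%N,
    mexpr m 0 2%:R = (q + t)%N /\ mexpr m 2%:R 0 = (q + s)%N &
    mexpr m 1 2%:R = (r + s)%N /\ mexpr m 2%:R 1 = (r + t)%N].
Proof.
move=> m0; rewrite !balancedE !big_ord3 /= !(m0 0 1, m0 1 0, m0 0 2%:R,
  m0 2%:R 0, m0 1 2%:R, m0 2%:R 1) //.
rewrite /w210 /w120 /= => /eqP e1 /eqP e2.
have [le|/ltnW le] := leqP (mexpr m 1 0) (mexpr m 0 1).
  exists (mexpr m 1 0), (mexpr m 0 2%:R), (mexpr m 2%:R 1),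
    (mexpr m 0%R 1%R - mexpr m 1%R 0%R)%N, 0%N.
  by split; split; lia.
exists (mexpr m 0 1), (mexpr m 2%:R 0), (mexpr m 1 2%:R), 0%N,
  (mexpr m 1%R 0%R - mexpr m 0%R 1%R)%N.
by split; split; lia.
Qed.

(** * Elimination of the eigenvalues *)

Section Generation.
Variable K : numClosedFieldType.
Local Notation SL3 := (SL K 3).
Implicit Types (x : SL3 * SL3).

Lemma slice_entry x i j : is_slice x -> i != j -> val x.1 i j = 0.
Proof. by move=> ->; elim/ord3_ind: i; elim/ord3_ind: j; rewrite mxE. Qed.

Lemma prod_entries x (m : 'X_{1..3 * 3 + 3 * 3}) : \prod_k entries x k ^+ m k =
  (\prod_i \prod_j val x.1 i j ^+ mexpl m i j) *
  (\prod_i \prod_j val x.2 i j ^+ mexpr m i j).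
Proof.
rewrite big_entries; congr (_ * _); apply: eq_bigr => i _;
  apply: eq_bigr => j _.
  by rewrite entriesl.
by rewrite entriesr.
Qed.

Lemma loc_monomial (m : 'X_{1..3 * 3 + 3 * 3}) :
  balanced w210 m -> balanced w120 m ->
  localized (fun x => \prod_k entries x k ^+ m k).
Proof.
(* A monomial containing an off-diagonal entry of the first matrix vanishes on the slice; for the
   others [balanced_cycles] applies. *)
move=> b1 b2; case: (boolP [exists i, exists j,
  (i != j) && (mexpl m i j != 0%N)]).
  move=> /existsP[i /existsP[j /andP[ij mij]]].
  apply: loc_ext (loc_cst 0) _ => x sx; rewrite prod_entries.
  by rewrite (bigD1 i) //= (bigD1 j) //= slice_entry // expr0n (negPf mij)
    !mul0r.
move=> ne; have m0 i j : i != j -> mexpl m i j = 0%N.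
  move=> ij; apply/eqP; apply: contraNT ne => mij.
  by apply/existsP; exists i; apply/existsP; exists j; rewrite ij.
have [p [q [r [s [t [[e1 e2] [e3 e4] [e5 e6]]]]]]] := balanced_cycles m0 b1 b2.
have D := @loc_diag K; have [p0 p1 p2] := loc_2cycles K;
  have [c1 c2] := loc_3cycles K.
have lA i j : localized (fun x => val x.1 i j ^+ mexpl m i j).
  have [<-|ij] := eqVneq i j; first exact: locX (loc_eig K i).
  by apply: loc_ext (loc_cst 1) _ => x _; rewrite m0.
have lB := locM (locM (locM (locM (locM (locX p p2) (locX q p1)) (locX r p0))
  (locX s c1)) (locX t c2))
  (locM (locM (locX (mexpr m 0 0) (D 0)) (locX (mexpr m 1 1) (D 1))) (locX
    (mexpr m 2%:R 2%:R) (D 2%:R))).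
have lA' := loc_prod (index_enum _) (fun i => loc_prod (index_enum _) (lA i)).
apply: loc_ext (locM lA' lB) _ => x _; rewrite prod_entries; congr (_ * _).
rewrite !big_ord3 /= e1 e2 e3 e4 e5 e6 /=.
move: (sval x.2 0 0) (sval x.2 0 1) (sval x.2 0 2%:R) (sval x.2 1 0) (sval x.2
  1 1) (sval x.2 1 2%:R)
  (sval x.2 2%:R 0) (sval x.2 2%:R 1) (sval x.2 2%:R 2%:R) (mexpr m 0 0) (mexpr
    m 1 1) (mexpr m 2%:R 2%:R).
clear; move=> b00 b01 b02 b10 b11 b12 b20 b21 b22 m0 m1 m2.
by rewrite !exprMn !exprD; ring.
Qed.

Lemma loc_invariant (F : SL3 * SL3 -> K^o) :
  polynomial_function F -> invariant_function F -> localized F.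
Proof.
move=> [p Fp] iF.
have := @loc_sum K _ (msupp p) (fun m => balanced w210 m && balanced w120 m)
  (fun m x => p@_m * \prod_k entries x k ^+ m k).
move=> /(_ _)/loc_ext; apply.
  by move=> m /andP[b1 b2]; apply: locM (loc_cst _) (loc_monomial b1 b2).
by move=> x _; rewrite (invariant_balanced Fp iF).
Qed.

(** Only even powers of the Vandermonde determinant are polynomials in the traces, so the exponent
    is doubled. *)
Lemma loc_even phi : @localized K phi -> exists N (h : {mpoly K[3 + 9]}),
  forall x, is_slice x -> phi x *
    (discA K).@[traces x] ^+ N = h.@[slice_coord x].
Proof.
move=> [N [h hE]]; exists N.
have [|h' h'E] := @loc_le K phi N (2 * N) h _ hE; first by lia.
by exists h' => x sx; rewrite -h'E // (discA_diag sx) exprM.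
Qed.

Definition widen9 (i : 'I_8) : 'I_9 := widen_ord (leqnSn 8) i.

Lemma traces9_w9 x i : traces9 x (widen9 i) = traces x i.
Proof. by rewrite -traces9_widen. Qed.

(* [a] and [b] are two of the roots of the cubic with coefficients [t7], [t0],
  1. *)
Definition cubic_pair (a b : K) (t : 'I_9 -> K) :=
  a ^+ 3 = t (widen9 'o_7) * a ^+ 2 - t (widen9 'o_0) * a + 1 /\
  b ^+ 2 = - a ^+ 2 + t (widen9 'o_7) * a - t (widen9 'o_0) +
    (t (widen9 'o_7) - a) * b.

(** The six monomials a^i b^j with i at most 2 and j at most 1 span the polynomials in the three
    roots over the symmetric ones. The relations of [cubic_pair], the cubic and its quotient by X -
    a evaluated at b, reduce a^3 and b^2. *)
Definition cubic_span (phi : K -> K -> ('I_9 -> K) -> K) :=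
  exists g0 g1 g2 h0 h1 h2 : {mpoly K[9]}, forall a b t, cubic_pair a b t ->
    phi a b t = g0.@[t] + g1.@[t] * a + g2.@[t] * a ^+ 2 +
      (h0.@[t] + h1.@[t] * a + h2.@[t] * a ^+ 2) * b.

Lemma cubic_span_ext phi psi : cubic_span phi ->
  (forall a b t, cubic_pair a b t -> psi a b t = phi a b t) -> cubic_span psi.
Proof.
move=> [g0 [g1 [g2 [h0 [h1 [h2 E]]]]]] e;
  exists g0, g1, g2, h0, h1, h2 => a b t ct.
by rewrite e // E.
Qed.

Lemma cubic_spanD phi psi : cubic_span phi -> cubic_span psi ->
  cubic_span (fun a b t => phi a b t + psi a b t).
Proof.
move=> [g0 [g1 [g2 [h0 [h1 [h2 E]]]]]] [g0' [g1' [g2' [h0' [h1' [h2' E']]]]]].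
exists (g0 + g0'), (g1 + g1'), (g2 + g2'), (h0 + h0'), (h1 + h1'),
  (h2 + h2') => a b t ct.
by rewrite E // E' // !mevalD; ring.
Qed.

Lemma cubic_spanZ (p : {mpoly K[9]}) phi : cubic_span phi ->
  cubic_span (fun a b t => p.@[t] * phi a b t).
Proof.
move=> [g0 [g1 [g2 [h0 [h1 [h2 E]]]]]].
exists (p * g0), (p * g1), (p * g2), (p * h0), (p * h1), (p * h2) => a b t ct.
by rewrite E // !mevalM; ring.
Qed.

Lemma cubic_spanMa phi : cubic_span phi ->
  cubic_span (fun a b t => a * phi a b t).
Proof.
move=> [g0 [g1 [g2 [h0 [h1 [h2 E]]]]]].
pose x : {mpoly K[9]} := 'X_(widen9 'o_7);
  pose y : {mpoly K[9]} := 'X_(widen9 'o_0).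
exists g2, (g0 - y * g2), (g1 + x * g2), h2, (h0 - y * h2), (h1 + x * h2) =>
  a b t ct.
rewrite E // !(mevalD, mevalN, mevalM) !mevalXU; case: ct => a3 _.
transitivity (g0.@[t] * a + g1.@[t] * a ^+ 2 + g2.@[t] * a ^+ 3 +
   (h0.@[t] * a + h1.@[t] * a ^+ 2 + h2.@[t] * a ^+ 3) * b); first by ring.
by rewrite a3; ring.
Qed.

Lemma cubic_spanMb phi : cubic_span phi ->
  cubic_span (fun a b t => b * phi a b t).
Proof.
move=> [g0 [g1 [g2 [h0 [h1 [h2 E]]]]]].
pose x : {mpoly K[9]} := 'X_(widen9 'o_7);
  pose y : {mpoly K[9]} := 'X_(widen9 'o_0).
have s0 : cubic_span (fun a b t => h0.@[t] + h1.@[t] * a + h2.@[t] * a ^+ 2).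
  by exists h0, h1, h2, 0, 0, 0 => a b t _; rewrite !meval0; ring.
have sb (p q r : {mpoly K[9]}) :
    cubic_span (fun a b t => (p.@[t] + q.@[t] * a + r.@[t] * a ^+ 2) * b).
  by exists 0, 0, 0, p, q, r => a b t _; rewrite !meval0; ring.
have S := cubic_spanD (cubic_spanD (cubic_spanD (sb g0 g1 g2)
   (cubic_spanZ (-1) (cubic_spanMa (cubic_spanMa s0))))
   (cubic_spanD (cubic_spanZ x (cubic_spanMa s0)) (cubic_spanZ (- y) s0)))
   (cubic_spanD (cubic_spanZ x (sb h0 h1 h2)) (cubic_spanZ (-1) (cubic_spanMa
     (sb h0 h1 h2)))).
apply: cubic_span_ext S _ => a b t ct; rewrite E //; case: ct => _ b2.
rewrite !mevalN !mevalXU !meval1.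
transitivity ((g0.@[t] + g1.@[t] * a + g2.@[t] * a ^+ 2) * b +
   (h0.@[t] + h1.@[t] * a + h2.@[t] * a ^+ 2) * b ^+ 2); first by ring.
by rewrite b2; ring.
Qed.

Definition cubic_coord (a b : K) (t : 'I_9 -> K) : 'I_(3 + 9) -> K :=
  fun k => match fintype.split k with
  | inl i => nth 0 [:: a; b; t (widen9 'o_7) - a - b] i | inr j => t j end.

Lemma cubic_span_mpoly (h : {mpoly K[3 + 9]}) :
  cubic_span (fun a b t => h.@[cubic_coord a b t]).
Proof.
(* Multiplication by [h] is shown to preserve the span; in this form the case of a product is a
   composition. *)
suff H phi : cubic_span phi -> cubic_span (fun a b t =>
  h.@[cubic_coord a b t] * phi a b t).
  have [|g0 [g1 [g2 [h0 [h1 [h2 E]]]]]] := H (fun _ _ _ => 1).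
    by exists 1, 0, 0, 0, 0, 0 => a b t _; rewrite !meval0 meval1; ring.
  by exists g0, g1, g2, h0, h1, h2 => a b t ct; rewrite -E // mulr1.
move: phi; elim/mpoly_alg_ind: h => [c|i|p q IHp IHq|p q IHp IHq] phi sphi.
- by apply: cubic_span_ext (cubic_spanZ c%:MP sphi) _ => a b t _;
  rewrite !mevalC.
- pose x : {mpoly K[9]} := 'X_(widen9 'o_7).
  have <- := fintype.splitK i; case: (fintype.split i) => j /=.
    elim/ord3_ind: j.
    + apply: cubic_span_ext (cubic_spanMa sphi) _ => a b t _.
      by rewrite mevalXU /cubic_coord (unsplitK (inl _ : 'I_3 + 'I_9)).
    + apply: cubic_span_ext (cubic_spanMb sphi) _ => a b t _.
      by rewrite mevalXU /cubic_coord (unsplitK (inl _ : 'I_3 + 'I_9)).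
    + apply: cubic_span_ext (cubic_spanD (cubic_spanZ x sphi) (cubic_spanZ (-1)
        (cubic_spanD (cubic_spanMa sphi) (cubic_spanMb sphi)))) _ => a b t _.
      rewrite mevalXU /cubic_coord (unsplitK (inl _ : 'I_3 + 'I_9)) /=.
      by rewrite mevalN meval1 mevalXU; ring.
  apply: cubic_span_ext (cubic_spanZ 'X_j sphi) _ => a b t _.
  by rewrite !mevalXU /cubic_coord (unsplitK (inr _ : 'I_3 + 'I_9)).
- apply: cubic_span_ext (cubic_spanD (IHp _ sphi) (IHq _ sphi)) _ => a b t _.
  by rewrite mevalD mulrDl.
- apply: cubic_span_ext (IHp _ (IHq _ sphi)) _ => a b t _.
  by rewrite mevalM mulrA.
Qed.

(* The identity holds for every ordering of the three eigenvalues; summing over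
   the six orderings removes them. *)
Lemma invariant_localized (F : SL3 * SL3 -> K^o) :
  polynomial_function F -> invariant_function F -> exists N (G : {mpoly K[9]}),
  forall x, (F x : K) * (discA K).@[traces x] ^+ N = G.@[traces9 x].
Proof.
move=> pF iF; have [N [h hE]] := loc_even (loc_invariant pF iF).
have [g0 [g1 [g2 [h0 [h1 [h2 E]]]]]] := cubic_span_mpoly h.
pose x : {mpoly K[9]} := 'X_(widen9 'o_7);
  pose y : {mpoly K[9]} := 'X_(widen9 'o_0).
pose D : {mpoly K[9]} := disc y x.
have DE z : D.@[traces9 z] = (discA K).@[traces z].
  by rewrite rmorph_disc /= !mevalXU !traces9_w9 meval_discA.
(* Over the six orderings the monomials 1, a, a^2, b, ab, a^2 b sum to 6, 2x, 2(x^2 - 2y), 2x, 2y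
   and xy - 3. The extra factor [D] makes both sides vanish where the discriminant does, where no
   diagonalization is available. *)
exists N.+1, (6%:R^-1 *: (D * (6%:R * g0 + 2%:R * x * g1 +
  2%:R * (x ^+ 2 - 2%:R * y) * g2
  + 2%:R * x * h0 + 2%:R * y * h1 + (x * y - 3%:R) * h2))) => z.
rewrite mevalZ mevalM DE exprS.
have [->|z0] := eqVneq (discA K).@[traces z] 0;
  first by rewrite !(mul0r, mulr0).
rewrite mulrCA [RHS]mulrCA; congr (_ * _).
have key a b c : a + b + c = \tr (val z.1) ->
  a * b + a * c + b * c = \tr (\adj (val z.1)) ->
    a * b * c = 1 -> (F z : K) * (discA K).@[traces z] ^+ N =
    g0.@[traces9 z] + g1.@[traces9 z] * a + g2.@[traces9 z] * a ^+ 2 +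
      (h0.@[traces9 z] + h1.@[traces9 z] * a + h2.@[traces9 z] * a ^+ 2) * b.
  move=> e1 e2 e3; have [g eg] := conj_slice e1 e2 e3 z0.
  have Ee i : eig (SL_act g z) i = diag3 a b c i i by rewrite /eig eg.
  have sl : is_slice (SL_act g z) by rewrite /is_slice !Ee eg !mxE.
  have := hE _ sl; rewrite iF traces_act => ->.
  have t9 : traces9 (SL_act g z) = traces9 z.
    by apply/funext => i; rewrite /traces9 traces_act commtr_act.
  have t7 : traces9 z (widen9 'o_7) = a + b + c by rewrite traces9_w9 e1.
  have t0 : traces9 z (widen9 'o_0) = a * b + a * c +
    b * c by rewrite traces9_w9 e2.
  rewrite -E; last first.
    by rewrite /cubic_pair t7 t0 -e3; split; ring.
  apply: meval_eq => k; rewrite /slice_coord /cubic_coord t9 t7.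
  case: (fintype.split k) => // i; rewrite Ee.
  elim/ord3_ind: i; rewrite mxE //=; ring.
have [a [b [c [e1 e2 e3]]]] := cubic_roots (\tr (val z.1)) (\tr (\adj (val
  z.1))).
have k1 := key a b c e1 e2 e3.
have k2 := key b a c ltac:(by rewrite -e1; ring) ltac:(by rewrite -e2;
  ring) ltac:(by rewrite -e3; ring).
have k3 := key a c b ltac:(by rewrite -e1; ring) ltac:(by rewrite -e2;
  ring) ltac:(by rewrite -e3; ring).
have k4 := key c a b ltac:(by rewrite -e1; ring) ltac:(by rewrite -e2;
  ring) ltac:(by rewrite -e3; ring).
have k5 := key b c a ltac:(by rewrite -e1; ring) ltac:(by rewrite -e2;
  ring) ltac:(by rewrite -e3; ring).
have k6 := key c b a ltac:(by rewrite -e1; ring) ltac:(by rewrite -e2;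
  ring) ltac:(by rewrite -e3; ring).
have t7 : traces9 z (widen9 'o_7) = a + b + c by rewrite traces9_w9 e1.
have t0 : traces9 z (widen9 'o_0) = a * b + a * c +
  b * c by rewrite traces9_w9 e2.
have ev : (6%:R * g0 + 2%:R * x * g1 + 2%:R * (x ^+ 2 - 2%:R * y) * g2 +
  2%:R * x * h0
    + 2%:R * y * h1 + (x * y - 3%:R) * h2).@[traces9 z] = 6%:R * g0.@[traces9 z]
    + 2%:R * x.@[traces9 z] * g1.@[traces9 z]
    + 2%:R * (x.@[traces9 z] ^+ 2 - 2%:R * y.@[traces9 z]) * g2.@[traces9 z]
    + 2%:R * x.@[traces9 z] * h0.@[traces9 z] +
      2%:R * y.@[traces9 z] * h1.@[traces9 z]
    + (x.@[traces9 z] * y.@[traces9 z] - 3%:R) * h2.@[traces9 z] by push_rmorph.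
rewrite ev !mevalXU t7 t0.
set f := F z * _ in k1 k2 k3 k4 k5 k6 *.
have h6 : 6%:R != 0 :> K by rewrite pnatr_eq0.
apply: (mulfI h6); rewrite [RHS]mulrA divff // mul1r.
transitivity (f + f + f + f + f + f); first by ring.
rewrite {1}k1 {1}k2 {1}k3 {1}k4 {1}k5 {1}k6.
(* The constant in xy - 3 stands for 3abc; in this form [ring] can compare the two sides. *)
have e33 : 3%:R = 3%:R * (a * b * c) by rewrite e3 mulr1.
by rewrite e33; ring.
Qed.

End Generation.

(** * Generators and relation of the ring of invariants *)

Lemma meval_mwiden (R : comNzRingType) n (p : {mpoly R[n]}) (v : 'I_n.+1 -> R) :
  (mwiden p).@[v] = p.@[v \o widen_ord (leqnSn n)].
Proof.
elim/mpoly_alg_ind: p => [c|i|p q IHp IHq|p q IHp IHq].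
- by rewrite mwidenC !mevalC.
- by rewrite mwidenX mnmwiden1 !mevalXU.
- by rewrite mwidenD !mevalD IHp IHq.
- by rewrite mwidenM !mevalM IHp IHq.
Qed.

Lemma meval_reindex (R : comNzRingType) n m (p : {mpoly R[n]}) (s : 'I_n ->
  'I_m) :
  exists q : {mpoly R[m]}, forall v, q.@[v] = p.@[v \o s].
Proof.
elim/mpoly_alg_ind: p => [c|i|p q [p' IHp] [q' IHq]|p q [p' IHp] [q' IHq]].
- by exists c%:MP => v; rewrite !mevalC.
- by exists 'X_(s i) => v; rewrite !mevalXU.
- by exists (p' + q') => v; rewrite !mevalD IHp IHq.
- by exists (p' * q') => v; rewrite !mevalM IHp IHq.
Qed.

Lemma muniXn (R : comNzRingType) n (p : {mpoly R[n.+1]}) k :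
  muni (p ^+ k) = muni p ^+ k.
Proof. exact: rmorphXn. Qed.

Lemma muni_disc (R : comNzRingType) n (p q : {mpoly R[n.+1]}) :
  muni (disc p q) = disc (muni p) (muni q).
Proof. exact: rmorph_disc. Qed.

Lemma dvd_muni (R : idomainType) n (p q d e : {mpoly R[n.+1]}) (c :
  {mpoly R[n]}) :
  muni e = c%:P -> c != 0 -> lead_coef (muni d) \is a GRing.unit ->
  p * e = q * d -> exists r, p = r * d.
Proof.
move=> ec c0 ud /(congr1 (@muni n R)); rewrite !muniM.
rewrite ec => eq_cp.
have {}eq_cp := etrans (mulrC _ _) (etrans eq_cp (mulrC _ _)).
have K := @dvdp_of_polyCM _ c (muni d) (muni p) (muni q) c0 ud.
have [r er] := K eq_cp; exists (unmuni r).
by rewrite -[LHS]muniK er unmuniM muniK mulrC.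
Qed.

Section HypersurfaceRing.
Variable K : numClosedFieldType.
Local Notation SL3 := (SL K 3).
Implicit Types (x : SL3 * SL3).

Definition hyp_poly : {mpoly K[9]} :=
  'X_ord_max ^+ 2 - mwiden (commtr_sum_poly K) * 'X_ord_max +
    mwiden (commtr_prod_poly K).

Lemma reduce_hyp_poly (G : {mpoly K[9]}) : exists q r0 r1,
  G = q * hyp_poly + mwiden r0 + mwiden r1 * 'X_ord_max.
Proof.
rewrite /hyp_poly; move: (commtr_sum_poly K) (commtr_prod_poly K) => P Q.
elim/mpoly_alg_ind: G => [c|i|p q [a [r0 [r1 ->]]] [b [s0 [s1 ->]]]|
   p q [a [r0 [r1 ->]]] [b [s0 [s1 ->]]]].
- by exists 0, c%:MP, 0; rewrite mwidenC mwiden0; ring.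
- elim/ordS_case: i => [i|].
    by exists 0, 'X_i, 0; rewrite mwidenX mnmwiden1 mwiden0; ring.
  by exists 0, 0, 1; rewrite mwiden0 mwiden1; ring.
- by exists (a + b), (r0 + s0), (r1 + s1); rewrite !mwidenD; ring.
(* The square of the last variable in the product of the two remainders is replaced by f + P X -
   Q. *)
- exists (a * (b * ('X_ord_max ^+ 2 - mwiden P * 'X_ord_max + mwiden Q) +
  mwiden s0 + mwiden s1 * 'X_ord_max)
     + b * (mwiden r0 + mwiden r1 * 'X_ord_max) + mwiden (r1 * s1)),
    (r0 * s0 - r1 * s1 * Q), (r0 * s1 + r1 * s0 + r1 * s1 * P).
  by rewrite mwidenB !mwidenD !mwidenM; ring.
Qed.

Lemma meval_traces9 (r0 r1 : {mpoly K[8]}) x :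
  (mwiden r0 + mwiden r1 * 'X_ord_max).@[traces9 x] =
  r0.@[traces x] + r1.@[traces x] * commtr x.
Proof. by rewrite mevalD mevalM !meval_mwiden traces9_widen mevalXU
  traces9_max. Qed.

Lemma meval_hyp_poly v : hyp_poly.@[v] = v ord_max ^+ 2
  - (commtr_sum_poly K).@[v \o widen_ord (leqnSn 8)] * v ord_max
  + (commtr_prod_poly K).@[v \o widen_ord (leqnSn 8)].
Proof.
rewrite /hyp_poly; move: (commtr_sum_poly K) (commtr_prod_poly K) => P Q.
by rewrite !expr2 mevalD mevalB !mevalM !meval_mwiden !mevalXU.
Qed.

Lemma hyp_poly_traces9 x : hyp_poly.@[traces9 x] = 0.
Proof.
rewrite meval_hyp_poly traces9_widen traces9_max -commtr_sum -commtr_prod; ring.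
Qed.

Lemma reduce_traces9 (G : {mpoly K[9]}) : exists r0 r1 : {mpoly K[8]},
  forall x, G.@[traces9 x] = r0.@[traces x] + r1.@[traces x] * commtr x.
Proof.
have [q [r0 [r1 ->]]] := reduce_hyp_poly G; exists r0, r1 => x.
by rewrite -addrA mevalD mevalM hyp_poly_traces9 mulr0 add0r meval_traces9.
Qed.

Lemma kernel_traces9 (G : {mpoly K[9]}) :
  (forall x, G.@[traces9 x] = 0) -> exists q, G = q * hyp_poly.
Proof.
have [q [r0 [r1 ->]]] := reduce_hyp_poly G => G0; exists q.
have [-> ->] : r0 = 0 /\ r1 = 0.
  apply: traces_commtr_indep => x;
    rewrite -meval_traces9 -[RHS](G0 x) -[in RHS]addrA.
  by rewrite [RHS]mevalD mevalM hyp_poly_traces9 mulr0 add0r.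
by rewrite !mwiden0; ring.
Qed.

Lemma muni_discA : exists2 D, muni (discA K) = D & lead_coef D = (- 4%:R)%:MP.
Proof.
pose Y : {mpoly K[7]} := 'X_(@Ordinal 7 0 isT).
exists (Poly [:: - 4%:R * Y ^+ 3 - 27%:R; 18%:R * Y; Y ^+ 2; (- 4%:R)%:MP]).
  have mY : muni ('X_('o_0) : {mpoly K[8]}) = Y%:P.
    rewrite -muniX_widen; congr (muni 'X__); exact: val_inj.
  have mX : muni ('X_('o_7) : {mpoly K[8]}) = 'X.
    rewrite -muniX_max; congr (muni 'X__); exact: val_inj.
  transitivity (disc (Y%:P) 'X); last rewrite /disc.
    by rewrite muni_disc mY mX.
  rewrite /= !cons_poly_def mpolyCN rmorphN /= mpolyC_nat; ring.
rewrite lead_coefE (@PolyK _ 0) //=.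
by rewrite mpolyC_eq0 oppr_eq0 pnatr_eq0.
Qed.

Lemma muni_discB : exists2 c, muni (discB K) = c%:P & c != 0.
Proof.
pose Z : {mpoly K[7]} := 'X_(@Ordinal 7 1 isT).
pose W : {mpoly K[7]} := 'X_(@Ordinal 7 2 isT).
exists (disc W Z); last first.
  (* The constant term -27 survives at the origin. *)
  apply: contraTneq isT => /(congr1 (meval (fun=> 0)));
    rewrite rmorph_disc meval0.
  rewrite /= !mevalXU /disc !expr0n /= !(mulr0, subr0, addr0) add0r => /eqP.
  by rewrite oppr_eq0 pnatr_eq0.
have mZ : muni ('X_('o_1) : {mpoly K[8]}) = Z%:P.
  rewrite -muniX_widen; congr (muni 'X__); exact: val_inj.
have mW : muni ('X_('o_2) : {mpoly K[8]}) = W%:P.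
  rewrite -muniX_widen; congr (muni 'X__); exact: val_inj.
rewrite (rmorph_disc (@polyC {mpoly K[7]})).
by rewrite muni_disc mW mZ.
Qed.

(* The two discriminants involve disjoint sets of variables, and [discA] has
   constant leading coefficient in the last one. *)
Lemma dvd_discA N M (p q : {mpoly K[8]}) :
  p * discB K ^+ M = q * discA K ^+ N -> exists r, p = r * discA K ^+ N.
Proof.
have [c ec c0] := muni_discB; have [D eD lD] := muni_discA.
apply: (@dvd_muni K 7 p q (discA K ^+ N) (discB K ^+ M) (c ^+ M)).
- by rewrite muniXn ec polyC_exp.
- by rewrite expf_neq0.
rewrite muniXn eD lead_coef_exp lD unitrX //.
apply/unitrP; exists (- 4%:R^-1)%:MP.
by rewrite -!mpolyCM !mulrNN mulVf ?mulfV ?pnatr_eq0 // mpolyC1.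
Qed.

Lemma traces_swap : exists s : 'I_8 -> 'I_8,
  [/\ forall x, traces (SL_swap x) = traces x \o s,
    s 'o_0 = 'o_2 & s 'o_7 = 'o_1].
Proof.
exists (fun i => nth 'o_0 [:: 'o_2; 'o_7; 'o_0; 'o_3; 'o_4; 'o_6; 'o_5;
  'o_1] i).
split=> // x; apply/funext; elim/ord8_ind; rewrite /traces /traces_mx //=;
  exact: mxtrace_mulC.
Qed.

Lemma polyfun_swap (F : SL3 * SL3 -> K^o) :
  polynomial_function F -> polynomial_function (fun x => F (SL_swap x)).
Proof.
move=> [p Fp]; have [q eq_] : polynomial_function (fun x =>
  p.@[entries (SL_swap x)] : K^o).
  apply: polyfun_mpoly; elim/entries_case => i j.
    by have [q eq_] := @polyfun_snd K 3 i j; exists q => x;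
      rewrite entriesl -eq_.
  by have [q eq_] := @polyfun_fst K 3 i j; exists q => x; rewrite entriesr -eq_.
by exists q => x; rewrite Fp eq_.
Qed.

Theorem invariant_generated (F : SL3 * SL3 -> K^o) :
  polynomial_function F -> invariant_function F ->
  exists G : {mpoly K[9]}, forall x, F x = G.@[traces9 x].
Proof.
move=> pF iF.
have [N [G eG]] := invariant_localized pF iF.
have [r0 [r1 er]] := reduce_traces9 G.
have [M [H eH]] : exists M (H : {mpoly K[9]}), forall x,
    F (SL_swap x) * (discA K).@[traces x] ^+ M = H.@[traces9 x].
  apply: invariant_localized (polyfun_swap pF) _ => g x.
  exact: (iF g (SL_swap x)).
have [s0 [s1 es]] := reduce_traces9 H.
have [s [swE sA sB]] := traces_swap.
have [s0' es0] := meval_reindex s0 s; have [s1' es1] := meval_reindex s1 s.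
(* The exchange of the two matrices turns c into c' = P - c; hence the sign of [s1'] and the term
   with [commtr_sum_poly]. *)
have FB x : F x * (discB K).@[traces x] ^+ M =
    (s0' + s1' * commtr_sum_poly K).@[traces x] - s1'.@[traces x] * commtr x.
  have := eH (SL_swap x); rewrite es swE -es0 -es1 meval_discA /= sA sB
    -meval_discB.
  have -> : SL_swap (SL_swap x) = x by case: (x).
  move=> ->; rewrite mevalD mevalM -commtr_sum.
  by rewrite -[commtr (SL_swap x)]/(commtr' x); ring.
have [e0 e1] : r0 * discB K ^+ M - (s0' +
  s1' * commtr_sum_poly K) * discA K ^+ N = 0 /\
    r1 * discB K ^+ M + s1' * discA K ^+ N = 0.
  apply: traces_commtr_indep => x.
  rewrite mevalB [X in _ + X * _]mevalD !(mevalM (traces x) _ (_ ^+ _))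
    !rmorphXn /=.
  have := er x; rewrite -eG => eA; have := FB x.
  set a := (discA K).@[traces x] ^+ N in eA *;
    set b := (discB K).@[traces x] ^+ M => eB.
  set f := F x in eA eB; set g := (s0' + _).@[_] in eB *.
  transitivity ((r0.@[traces x] + r1.@[traces x] * commtr x) * b
     - (g - s1'.@[traces x] * commtr x) * a); first by ring.
  by rewrite -eA -eB; ring.
have [g0 eg0] : exists g0, r0 = g0 * discA K ^+ N.
  by apply: (@dvd_discA N M _ (s0' + s1' * commtr_sum_poly K)); apply/eqP;
    rewrite -subr_eq0 e0.
have [g1 eg1] : exists g1, r1 = g1 * discA K ^+ N.
  apply: (@dvd_discA N M _ (- s1')); apply/eqP; rewrite mulNr -subr_eq0 opprK.
  by rewrite e1.
exists (mwiden g0 + mwiden g1 * 'X_ord_max) => x; rewrite meval_traces9.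
have [x1 [x1d _]] := generic_pair K.
apply/eqP; rewrite -subr_eq0; apply/eqP; move: x.
apply: (@polyfun_domain _ _ (fun x => (discA K).@[traces x] ^+ N) _ x1).
- exact/polyfunX/polyfun_traces_mpoly.
- apply: polyfunD => //; apply: polyfunN; apply: polyfunD.
    exact: polyfun_traces_mpoly.
  by apply: polyfunM; [exact: polyfun_traces_mpoly | exact: polyfun_commtr].
- move=> x; rewrite mulrBr mulrC eG er eg0 eg1 !mevalM !rmorphXn /=; ring.
- by rewrite expf_neq0.
Qed.

End HypersurfaceRing.

(** * Maximal ideals and residue fields *)

(** The points are avoided one at a time: the right half is kept if the point lies left of the
    midpoint, and the left quarter otherwise. *)
Lemma subinterval_avoiding (R : realFieldType) (a b : R) (l : seq R) : a < b ->
  exists c d, [/\ a <= c, c < d, d <= b & forall r, r \in l ->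
    ~~ (c <= r <= d)].
Proof.
move=> ab; elim: l => [|r l [c [d [ac cd db Hl]]]].
  by exists a, b; split.
pose m := (c + d) / 2; have cm : c < m by rewrite /m; lra.
have md : m < d by rewrite /m; lra.
have [rm|mr] := ltP r m.
  exists m, d; split=> //; first by lra.
  move=> s; rewrite inE => /orP[/eqP ->|/Hl Hs].
    by rewrite (lt_geF rm).
  by apply: contra Hs => /andP[ms ->]; rewrite andbT; lra.
exists c, ((c + m) / 2); split=> //; try lra.
move=> s; rewrite inE => /orP[/eqP ->|/Hl Hs].
  by apply/negP => /andP[_ rc]; lra.
by apply: contra Hs => /andP[-> sm] /=; lra.
Qed.

(** Cantor's nested intervals: interval n+1 avoids the finite set [s n], and the supremum of the
    left ends lies in all intervals. *)
Lemma uncountable_real (R : realType) (s : nat -> seq R) :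
  exists r, forall n, r \notin s n.
Proof.
(* The condition holds vacuously on degenerate intervals, so that [choice] yields a total step
   function; [I1] shows that they never occur. *)
pose ok (n : nat) (I J : R * R) := I.1 < I.2 ->
  [/\ I.1 <= J.1, J.1 < J.2, J.2 <= I.2 &
      forall r, r \in s n -> ~~ (J.1 <= r <= J.2)].
have [step stepP] : {step : nat * (R * R) ->
  R * R & forall z, ok z.1 z.2 (step z)}.
  apply: (@choice _ _ (fun z J => ok z.1 z.2 J)) => -[n [a b]].
  have [/(@subinterval_avoiding _ a b (s n))[c [d H]]|ba] := ltP a b.
    by exists (c, d) => _.
  by exists (a, b) => /=; rewrite /ok /= ltNge ba.
pose I := fix I n := if n is m.+1 then step (m, I m) else (0, 1).
have I1 n : (I n).1 < (I n).2.
  by elim: n => [|n IHn] /=; [exact: ltr01 | have [] := stepP (n, I n) IHn].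
have IP n := stepP (n, I n) (I1 n).
have mono n k : (I n).1 <= (I (n + k)%N).1 /\ (I (n + k)%N).2 <= (I n).2.
  elim: k => [|k [IH1 IH2]]; first by rewrite addn0.
  rewrite addnS; have [h1 _ h2 _] := IP (n + k)%N.
  by split; [exact: le_trans IH1 h1 | exact: le_trans h2 IH2].
have ab n k : (I n).1 <= (I k).2.
  have [h1 _] := mono n k; have [_ h2] := mono k n.
  by rewrite (le_trans h1) // (le_trans (ltW (I1 _))) // addnC.
pose E : set R := range (fun n => (I n).1).
have E0 : E !=set0 by exists (I 0%N).1, 0%N.
have Eb k : ubound E (I k).2 by move=> _ [n _ <-].
have Es : has_sup E by split=> //; exists (I 0%N).2.
exists (sup E) => n; apply/negP => sn.
have [_ _ _ /(_ _ sn)/negP] := IP n; apply; apply/andP; split.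
  by apply: sup_upper_bound => //; exists n.+1.
by apply: ge_sup E0 (Eb n.+1).
Qed.

(** Otherwise countably many finite fibers would cover the reals. *)
Lemma infinite_fiber (R : realType) (P : R -> nat -> Prop) :
  (forall r, exists n, P r n) ->
  exists n, forall N, exists c : 'I_N -> R, injective c /\ forall j, P (c j) n.
Proof.
move=> HP; have [n infn] : exists n, infinite_set [set r | P r n].
  apply/not_existsP => fin.
  have [s sP] : {s : nat -> seq R & forall n, [set r | P r n] = [set` s n]}.
    apply: (@choice _ _ (fun n (l : seq R) => [set r | P r n] = [set` l])) => n.
    by have /contrapT/finite_seqP := fin n.
  have [r rs] := uncountable_real s; have [n Prn] := HP r.
  have : [set r | P r n] r by [].
  by rewrite sP /=; apply/negP.
exists n => N; have /infiniteP/card_leP[f] := infn.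
have T (k : nat) : k \in [set: nat] by rewrite inE.
exists (fun j : 'I_N => set_val (f (SigSub (T j)))); split=> [j k /val_inj e|j].
  have := @inj _ _ setT f (SigSub (T j)) (SigSub (T k));
    rewrite !inE => /(_ I I e).
  by move=> /(congr1 val) ejk; apply: val_inj.
exact: (set_valP (f (SigSub (T j)))).
Qed.


Section MaximalIdeals.
Variables (K : fieldType) (A : comAlgType K) (m : set A).
Hypothesis max_m : is_maximal_ideal m.

Lemma maxideal_ideal : is_ideal m. Proof. by case: max_m. Qed.
Lemma maxideal_proper : ~ m 1. Proof. by case: max_m. Qed.
Lemma maxideal0 : m 0. Proof. by have [] := maxideal_ideal. Qed.
Lemma maxidealD a b : m a -> m b -> m (a + b).
Proof. by have [_ h _] := maxideal_ideal; exact: h. Qed.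
Lemma maxidealM a b : m b -> m (a * b).
Proof. by have [_ _ h] := maxideal_ideal; exact: h. Qed.
Lemma maxidealN a : m a -> m (- a).
Proof. by rewrite -mulN1r; exact: maxidealM. Qed.
Lemma maxidealB a b : m a -> m b -> m (a - b).
Proof. by move=> ma mb; apply: maxidealD ma (maxidealN mb). Qed.

Lemma maxideal_sum (I : Type) (r : seq I) (F : I -> A) :
  (forall i, m (F i)) -> m (\sum_(i <- r) F i).
Proof.
move=> mF; elim: r => [|i r IHr]; first by rewrite big_nil; exact: maxideal0.
by rewrite big_cons; apply: maxidealD.
Qed.

Lemma maxideal_scalar (c : K) : m c%:A -> c = 0.
Proof.
move=> mc; apply/eqP; apply: contra_notT maxideal_proper => c0.
by rewrite -[1]scale1r -(mulVf c0) -scalerA -mulr_algl; exact: maxidealM.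
Qed.

Lemma maxideal_inverse a : ~ m a -> exists g, m (g * a - 1).
Proof.
move=> nma; pose I : set A := [set z | exists u v, m u /\ z = u + v * a].
have II : is_ideal I.
  split; first by exists 0, 0; rewrite mul0r addr0; split=> //;
    exact: maxideal0.
    move=> _ _ [u [v [mu ->]]] [u' [v' [mu' ->]]]; exists (u + u'), (v + v').
    by split; [exact: maxidealD | ring].
  move=> b _ [u [v [mu ->]]]; exists (b * u), (b * v).
  by split; [exact: maxidealM | ring].
have mI : m `<=` I by move=> u mu; exists u, 0; rewrite mul0r addr0.
have [[u [v [mu e]]]|nI1] := pselect (I 1).
  by exists v; rewrite e (_ : _ - _ = - u); [exact: maxidealN | ring].
have [_ _ /(_ I II nI1 mI) eI] := max_m; case: nma; rewrite -eI.
by exists 0, 1; split; [exact: maxideal0 | ring].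
Qed.

Lemma maxideal_prime a b : m (a * b) -> m a \/ m b.
Proof.
move=> mab; have [|/maxideal_inverse[g mg]] := pselect (m a); [by left | right].
rewrite (_ : b = g * (a * b) - b * (g * a - 1)); last by ring.
by apply: maxidealB; exact: maxidealM.
Qed.

End MaximalIdeals.

Section Nullstellensatz.
Local Open Scope complex_scope.
Variables (R : realType) (n : nat) (A : comAlgType R[i]).
Variable psi : {lrmorphism {mpoly R[i][n]} -> A}.
Hypothesis psi_surj : forall a, exists p, psi p = a.

(* [R] being uncountable, infinitely many of the inverses of the [a - c] modulo
   [m] lie in a finite dimensional space; a linear relation between them gives
   a nonzero polynomial in [a] that belongs to [m]. *)
Lemma maxideal_residue (m : set A) (a : A) : is_maximal_ideal m ->
  exists c : R[i], m (a - c%:A).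
Proof.
move=> mm; apply: contrapT => /forallNP noc.
(* Real shifts are uncountably many already; [d] bounds the degree of a polynomial that represents
   an inverse of a - r modulo [m]. *)
pose P (r : R) (d : nat) := exists g : {mpoly R[i][n]},
  (msize g <= d)%N /\ m (psi g * (a - (r%:C)%:A) - 1).
have [|d Pd] := @infinite_fiber R P.
  move=> r; have [g mg] := maxideal_inverse mm (noc r%:C).
  by have [p ep] := psi_surj g; exists (msize p), p; rewrite ep.
(* [N] is the dimension of the space of polynomials of size at most [d], so that N + 1 of them
   satisfy a linear relation. *)
pose N := #|{: 'X_{1..n < d}}|.
have [c [c_inj Pc]] := Pd N.+1.
have [g gP] := choice Pc.
pose G : 'M[R[i]]_(N.+1, N) := \matrix_(j, k) (g j)@_(enum_val k :
  'X_{1..n < d}).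
have : kermx G != 0.
  by rewrite kermx_eq0 /row_free neq_ltn ltnS rank_leq_col.
move=> /rowV0Pn[al /sub_kermxP alG al0].
have rel : \sum_j al 0 j *: g j = 0.
  apply/mpolyP => k; rewrite mcoeff0 raddf_sum /=.
  under eq_bigr do rewrite mcoeffZ.
  have [kd|dk] := ltnP (mdeg k) d; last first.
    rewrite big1 // => j _; rewrite memN_msupp_eq0 ?mulr0 //.
    by apply: msize_mdeg_ge; rewrite (leq_trans _ dk) //; case: (gP j).
  move/matrixP: alG => /(_ 0 (enum_rank (BMultinom kd))); rewrite !mxE => e;
    rewrite -[RHS]e.
  by apply: eq_bigr => j _; rewrite !mxE enum_rankK.
pose x j : A := a - ((c j)%:C)%:A.
(* The relation between the inverses of the a - c_j, multiplied by all the a - c_k. At a c_j with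
   nonzero coefficient only the j-th summand survives, so [h] is not zero. *)
pose h : {poly R[i]} := \sum_j al 0 j *: \prod_(k | k != j) ('X - ((c
  k)%:C)%:P).
have h0 : h != 0.
  have /rV0Pn[j alj] := al0.
  apply: contra_neq alj => h0; have := congr1 (horner^~ (c j)%:C) h0.
  rewrite horner0 horner_sum (bigD1 j) //= [X in _ + X]big1 => [|k kj].
    rewrite addr0 hornerZ horner_prod => /eqP;
      rewrite mulf_eq0 => /orP[/eqP //|].
    move=> /prodf_eq0[k kj]; rewrite hornerXsubC subr_eq0 =>
      /eqP/complexI/c_inj e.
    by rewrite e eqxx in kj.
  rewrite hornerZ horner_prod (bigD1 j) 1?eq_sym //= hornerXsubC subrr.
  by rewrite mul0r mulr0.
have lin c0 : horner_alg a ('X - c0%:P) = a - c0%:A.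
  by rewrite rmorphB /= horner_algX horner_algC.
have mh : m (horner_alg a h).
  rewrite raddf_sum /=.
  have e : \sum_j al 0 j *: (psi (g j) * \prod_k x k) = 0.
    have : psi (\sum_j al 0 j *: g j) *
      \prod_k x k = 0 by rewrite rel linear0 mul0r.
    rewrite linear_sum mulr_suml; apply: etrans.
    by apply: eq_bigr => j _; rewrite linearZ -scalerAl.
  rewrite (_ : \sum_j _ = - \sum_j al 0 j *: ((psi (g j) * x j - 1) *
    \prod_(k | k != j) x k)).
    apply: maxidealN => //; apply: maxideal_sum => // j.
    rewrite -mulr_algl mulrA mulrAC; apply: maxidealM => //.
    by have [] := gP j.
  transitivity (\sum_j (al 0 j *: (psi (g j) * \prod_k x k) -
      al 0 j *: ((psi (g j) * x j - 1) * \prod_(k | k != j) x k))); last first.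
    by rewrite sumrB e sub0r.
  apply: eq_bigr => j _; rewrite linearZ /= rmorph_prod /= [\prod_k x k](bigD1
    j) //= -scalerBr.
  rewrite mulr_algl; congr (_ *: _);
    rewrite [(_ - 1) * _]mulrBl mul1r mulrA opprB addrC subrK.
  by apply: eq_bigr => k _; rewrite lin.
(* As [m] is prime and contains h(a), it contains the leading coefficient, a nonzero scalar, or a
   linear factor a - c0; both are excluded. *)
have [r er] := closed_field_poly_normal h.
move: mh; rewrite er linearZ /= rmorph_prod /= => /(maxideal_prime mm)[].
  move=> /(maxideal_scalar mm) /eqP; rewrite lead_coef_eq0; exact/negP.
elim: r {er} => [|c0 r IHr]; first by rewrite big_nil; exact: maxideal_proper.
rewrite big_cons => /(maxideal_prime mm)[|/IHr //].
by rewrite lin => /noc.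
Qed.

End Nullstellensatz.

(** * The hypersurface *)

Section Degree.

Section DegreeBounds.
Variables (R : idomainType) (n : nat).
Implicit Types p q : {mpoly R[n]}.

Definition deg_le p d := (msize p <= d.+1)%N.

Lemma deg_leW p d d' : deg_le p d -> (d <= d')%N -> deg_le p d'.
Proof. by move=> pd dd'; apply: leq_trans pd _. Qed.

Lemma deg_leD p q d : deg_le p d -> deg_le q d -> deg_le (p + q) d.
Proof.
by move=> pd qd; apply: leq_trans (msizeD_le _ _) _; rewrite geq_max;
  apply/andP.
Qed.

Lemma deg_leN p d : deg_le p d -> deg_le (- p) d.
Proof. by rewrite /deg_le msizeN. Qed.

Lemma deg_leM p q d e : deg_le p d -> deg_le q e -> deg_le (p * q) (d + e).
Proof.
rewrite /deg_le; have [->|p0] := eqVneq p 0; first by rewrite mul0r msize0.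
have [->|q0] := eqVneq q 0; first by rewrite mulr0 msize0.
by rewrite msizeM //; lia.
Qed.

Lemma deg_leXn p d k : deg_le p d -> deg_le (p ^+ k) (k * d).
Proof.
move=> pd; elim: k => [|k IHk]; first by rewrite /deg_le expr0 msize1.
by rewrite exprS mulSn; apply: deg_leM.
Qed.

Lemma deg_leX i : deg_le 'X_i 1.
Proof. by rewrite /deg_le msizeX mdeg1. Qed.

Lemma deg_le_nat k : deg_le k%:R 0.
Proof. by rewrite /deg_le -mpolyC_nat msizeC leq_b1. Qed.

Lemma deg_le1 : deg_le 1 0. Proof. exact: (deg_le_nat 1). Qed.

(** Restriction to a line through the origin cannot raise the degree; this serves as a lower bound
    for the degree of [hyp_poly]. *)
Lemma size_mmap_line (c : 'I_n -> R) p :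
  (size (mmap polyC (fun i => c i *: 'X) p) <= msize p)%N.
Proof.
apply: (leq_trans (size_sum _ _ _));
  rewrite msizeE big_seq [X in (_ <= X)%N]big_seq.
elim/big_rec2: _ => // m a b _ ab; rewrite geq_max leq_max; apply/andP; split;
  last first.
  by rewrite leq_max ab orbT.
apply/orP; left; rewrite mul_polyC (leq_trans (size_scale_leq _ _)) // /mmap1.
have -> : \prod_(i < n) (c i *: 'X) ^+ m i =
  (\prod_i c i ^+ m i) *: 'X^(mdeg m) :> {poly R}.
  rewrite -mul_polyC rmorph_prod /= mdegE expr_sum -big_split /=.
  by apply: eq_bigr => i _; rewrite -mul_polyC exprMn rmorphXn.
by rewrite (leq_trans (size_scale_leq _ _)) // size_polyXn.
Qed.

End DegreeBounds.

Variable K : numClosedFieldType.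

Ltac deg_bound :=
  lazymatch goal with
  | |- is_true (deg_le 1 _) => apply: deg_le1
  | |- is_true (deg_le _%:R _) => apply: deg_le_nat
  | |- is_true (deg_le (- _) _) => apply: deg_leN; deg_bound
  | |- is_true (deg_le (_ ^+ _) _) => eapply deg_leXn; deg_bound
  | |- is_true (deg_le (_ * _) _) => eapply deg_leM; deg_bound
  | |- _ => apply: deg_leX
  end.

Ltac deg_bound_sum :=
  lazymatch goal with
  | |- is_true (deg_le (- _) _) => apply: deg_leN; deg_bound_sum
  | |- is_true (deg_le (_ + _) _) => apply: deg_leD; deg_bound_sum
  | |- _ => eapply deg_leW; [deg_bound | by []]
  end.

Lemma mwiden_sum_poly : mwiden (commtr_sum_poly K) =
  eval8 (@commP _) (fun i => 'X_(widen9 i)).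
Proof.
rewrite /commtr_sum_poly rmorph_commP; congr eval8; apply/funext => i.
by rewrite /= mwidenX mnmwiden1.
Qed.

Lemma mwiden_prod_poly : mwiden (commtr_prod_poly K) =
  eval8 (@commQ _) (fun i => 'X_(widen9 i)).
Proof.
rewrite /commtr_prod_poly rmorph_commQ; congr eval8; apply/funext => i.
by rewrite /= mwidenX mnmwiden1.
Qed.

Lemma deg_hyp_poly : deg_le (hyp_poly K) 6.
Proof.
rewrite /hyp_poly mwiden_sum_poly mwiden_prod_poly; apply: deg_leD;
  [apply: deg_leD|].
- by rewrite expr2; apply: (@deg_leW _ _ _ 2) => //;
  apply: (@deg_leM _ _ _ _ 1 1); exact: deg_leX.
- apply: deg_leN; apply: (@deg_leW _ _ _ (5 + 1)) => //; apply: deg_leM;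
  last exact: deg_leX.
  rewrite /eval8 /commP; deg_bound_sum.
- rewrite /eval8 /commQ; deg_bound_sum.
Qed.

(** The traces of both matrices and of their inverses vary equally, and all other coordinates
    vanish. The last one being zero, only Q remains, and its two terms of degree 6 contribute 2
    X^6. *)
Definition line_dir (i : 'I_9) : K := nth 0 [:: 1; 1; 1; 0; 0; 0; 0; 1; 0] i.

Lemma hyp_poly_line : mmap polyC (fun i => line_dir i *: 'X) (hyp_poly K) =
  9%:R%:P - 12%:R *: 'X^2 + 4%:R *: 'X^3 + 'X^4 - 4%:R *: 'X^5 + 2%:R *: 'X^6.
Proof.
have X0 : mmap polyC (fun i => line_dir i *: 'X) 'X_ord_max = 0.
  by rewrite mmapX mmap1U /line_dir /= scale0r.
pose phi : {rmorphism {mpoly K[9]} ->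
  {poly K}} := mmap polyC (fun i => line_dir i *: 'X).
rewrite -[mmap _ _]/(phi : _ -> _) in X0 *.
have e : phi (hyp_poly K) = 0 ^+ 2 - phi (mwiden (commtr_sum_poly K)) * 0
    + eval8 (@commQ _) (phi \o (fun i => 'X_(widen9 i))).
  rewrite /hyp_poly mwiden_prod_poly -rmorph_commQ; apply: rmorphD_eq => //.
  by apply: rmorphD_eq; [apply: rmorphX_eq | apply: rmorphN_eq;
    apply: rmorphM_eq].
have phiX i : phi 'X_i = line_dir i *: 'X by rewrite /phi /= mmapX mmap1U.
rewrite e mulr0 /eval8 /= !phiX /line_dir /= !scale0r !scale1r /commQ.
by rewrite -!mul_polyC !polyC_natr; ring.
Qed.

Lemma msize_hyp_poly : msize (hyp_poly K) = 7%N.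
Proof.
apply/eqP; rewrite eqn_leq; apply/andP; split; first exact: deg_hyp_poly.
rewrite ltnNge; apply/negP => le6.
have := leq_trans (size_mmap_line line_dir (hyp_poly K)) le6.
rewrite hyp_poly_line => /(nth_default 0)/eqP.
rewrite !(coefD, coefN, coefZ, coefXn, coefC) /= !mulr0 !(addr0,
  subr0) add0r mulr1.
by rewrite pnatr_eq0.
Qed.

End Degree.

Lemma inj_surj_bij (T U : Type) (f : T -> U) : injective f ->
  (forall y, exists x, f x = y) -> bijective f.
Proof.
move=> f_inj /choice[g gK]; exists g => // x.
by apply: f_inj; rewrite gK.
Qed.

(** * The ring isomorphism, and maximal ideals attached to points *)

Section TraceMorphism.
Local Open Scope quotient_scope.
Local Open Scope classical_set_scope.
Variable K : numClosedFieldType.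
Local Notation Inv := (invariant_ring K 3).

Lemma traces9_act g (x : SL K 3 * SL K 3) : traces9 (SL_act g x) = traces9 x.
Proof. by apply/funext => i; rewrite /traces9 traces_act commtr_act. Qed.

Lemma inv_poly_traces9 (p : {mpoly K[9]}) :
  inv_poly (fun x : SL K 3 * SL K 3 => p.@[traces9 x] : K^o).
Proof.
apply/asboolP; split=> [|g x]; last by rewrite traces9_act.
apply: polyfun_mpoly; apply: ordS_case => [i|].
  have [q eq_] := polyfun_traces K i; exists q => x.
  by rewrite -eq_ -[LHS]/((traces9 x \o _) i) traces9_widen.
by have [q eq_] := @polyfun_commtr K; exists q => x; rewrite -eq_ traces9_max.
Qed.

Definition trace_map (p : {mpoly K[9]}) : Inv := Sub _ (inv_poly_traces9 p).

Lemma trace_mapE p x : val (trace_map p) x = p.@[traces9 x].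
Proof. by []. Qed.

Lemma trace_map_zmod : zmod_morphism trace_map.
Proof. by move=> p q; apply/val_inj/funext => x; rewrite /= mevalB. Qed.

Lemma trace_map_monoid : monoid_morphism trace_map.
Proof.
split; first by apply/val_inj/funext => x; rewrite /= meval1.
by move=> p q; apply/val_inj/funext => x; rewrite /= mevalM.
Qed.

Lemma trace_map_scalable : scalable trace_map.
Proof. by move=> a p; apply/val_inj/funext => x; rewrite /= mevalZ. Qed.

HB.instance Definition _ := GRing.isZmodMorphism.Build _ _ trace_map
  trace_map_zmod.
HB.instance Definition _ := GRing.isMonoidMorphism.Build _ _ trace_map
  trace_map_monoid.
HB.instance Definition _ := GRing.isScalable.Build _ _ _ _ trace_map
  trace_map_scalable.

Lemma trace_mapC (a : K) : trace_map a%:MP = a%:A.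
Proof. by rewrite -[a%:MP]mulr1 mul_mpolyC linearZ rmorph1. Qed.

Lemma trace_map_surj (F : Inv) : exists p, trace_map p = F.
Proof.
have /asboolP[pF iF] := valP F.
have [p ep] := invariant_generated pF iF; exists p.
by apply/val_inj/funext => x; rewrite trace_mapE ep.
Qed.

Lemma trace_map_kernel p : trace_map p = 0 <-> exists q, p = q * hyp_poly K.
Proof.
split=> [p0|[q ->]].
  apply: kernel_traces9 => x; rewrite -trace_mapE p0 //.
by apply/val_inj/funext => x; rewrite trace_mapE mevalM hyp_poly_traces9 mulr0.
Qed.

Lemma hyp_poly_nonconst : (1 < msize (hyp_poly K))%N.
Proof. by rewrite msize_hyp_poly. Qed.

Definition hyp_nonconst := NonconstMpoly hyp_poly_nonconst.
Local Notation H := (hypersurface_ring hyp_nonconst).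
Local Notation piH := (\pi_{ideal_quot (principal hyp_nonconst)}).

Definition hs_map (u : H) : Inv := trace_map (repr u).

Lemma hs_map_pi p : hs_map (piH p) = trace_map p.
Proof.
rewrite /hs_map; have : repr (piH p) - p \in principal hyp_nonconst.
  by rewrite Quotient.idealrBE reprK.
move=> /asboolP /trace_map_kernel; rewrite raddfB => /eqP.
by rewrite subr_eq0 => /eqP.
Qed.

Lemma piH_surj (u : H) : exists p, u = piH p.
Proof. by exists (repr u); rewrite reprK. Qed.

Lemma hs_map_zmod : zmod_morphism hs_map.
Proof.
move=> u v; have [p ->] := piH_surj u; have [q ->] := piH_surj v.
have -> : piH p - piH q = piH (p - q) by rewrite rmorphB.
by rewrite !hs_map_pi raddfB.
Qed.

Lemma hs_map_monoid : monoid_morphism hs_map.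
Proof.
split.
  have -> : (1 : H) = piH 1 by rewrite rmorph1.
  by rewrite hs_map_pi rmorph1.
move=> u v; have [p ->] := piH_surj u; have [q ->] := piH_surj v.
have -> : piH p * piH q = piH (p * q) by rewrite rmorphM.
by rewrite !hs_map_pi rmorphM.
Qed.

Lemma hs_map_scalable : scalable hs_map.
Proof.
move=> a u; have [p ->] := piH_surj u.
have -> : a *: (piH p : H) = piH (a *: p) by rewrite -mul_mpolyC rmorphM.
by rewrite !hs_map_pi linearZ.
Qed.

HB.instance Definition _ := GRing.isZmodMorphism.Build _ _ hs_map hs_map_zmod.
HB.instance Definition _ := GRing.isMonoidMorphism.Build _ _ hs_map
  hs_map_monoid.
HB.instance Definition _ := GRing.isScalable.Build _ _ _ _ hs_map
  hs_map_scalable.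

Definition hs_lrmorphism : {lrmorphism H -> Inv} := hs_map.

(** Surjectivity rests on [invariant_generated], injectivity on [kernel_traces9]. *)
Lemma hs_map_bij : bijective hs_map.
Proof.
apply: inj_surj_bij => [|F]; last first.
  by have [p <-] := trace_map_surj F; exists (piH p); rewrite hs_map_pi.
apply: raddf_inj => u; have [p ->] := piH_surj u => u0.
have /trace_map_kernel[q ->] : trace_map p = 0 by rewrite -hs_map_pi; exact: u0.
apply/eqP; rewrite -[0](rmorph0 piH) -Quotient.idealrBE subr0.
by apply/asboolP; exists q.
Qed.

(** The residue map modulo [m] is evaluation at the point [c] of K^9. By [eval_atP], a maximal [m]
    is then determined by [c]. *)
Definition eval_at (m : set Inv) (c : 'I_9 -> K) :=
  forall p, m (trace_map p - (p.@[c])%:A).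

Lemma eval_at_ind (m : set Inv) c : is_ideal m ->
  (forall i, m (trace_map 'X_i - (c i)%:A)) -> eval_at m c.
Proof.
move=> [m0 mD mM] mX; elim/mpoly_alg_ind => [a|i|p q IHp IHq|p q IHp IHq].
- by rewrite mevalC trace_mapC subrr.
- by rewrite mevalXU.
- rewrite mevalD raddfD scalerDl opprD addrACA; exact: mD.
- rewrite mevalM rmorphM /= (_ :
  _ - _ = trace_map q * (trace_map p - (p.@[c])%:A) +
     (p.@[c])%:A * (trace_map q - (q.@[c])%:A)).
    by apply: mD; exact: mM.
  have -> : (p.@[c] * q.@[c])%:A = (p.@[c])%:A * (q.@[c])%:A :> Inv.
    by rewrite -scalerAl mul1r scalerA.
  by move: (p.@[c])%:A (q.@[c])%:A (trace_map p) (trace_map q) => a b x y; ring.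
Qed.

Lemma eval_atP (m : set Inv) c p : is_maximal_ideal m -> eval_at m c ->
  m (trace_map p) <-> p.@[c] = 0.
Proof.
move=> mm mc; split=> [mp|p0]; last by have := mc p; rewrite p0 scale0r subr0.
apply: (maxideal_scalar mm); rewrite -[_%:A](subKr (trace_map p)).
by apply: maxidealB => //; exact: mc.
Qed.

Lemma zero_meval (c : 'I_9 -> K) p q : (hyp_poly K).@[c] = 0 ->
  trace_map p = trace_map q -> p.@[c] = q.@[c].
Proof.
move=> c0 /eqP; rewrite -subr_eq0 -raddfB => /eqP/trace_map_kernel[r e].
by apply/eqP; rewrite -subr_eq0 -mevalB e mevalM c0 mulr0.
Qed.

(** The image of the ideal of polynomials vanishing at [c]; it is proper when [c] lies on the
    hypersurface, by [zero_meval]. *)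
Definition max_at (c : 'I_9 -> K) : set Inv :=
  [set z | exists p, trace_map p = z /\ p.@[c] = 0].

Lemma max_at_ideal c : is_ideal (max_at c).
Proof.
split; first by exists 0; rewrite raddf0 meval0.
  move=> _ _ [p [<- p0]] [q [<- q0]]; exists (p + q).
  by rewrite raddfD mevalD p0 q0 addr0.
move=> a _ [q [<- q0]]; have [p <-] := trace_map_surj a; exists (p * q).
by rewrite rmorphM mevalM q0 mulr0.
Qed.

Lemma max_at_eval c : eval_at (max_at c) c.
Proof.
move=> p; exists (p - (p.@[c])%:MP); rewrite mevalB mevalC subrr; split=> //.
by rewrite raddfB /= trace_mapC.
Qed.

(** Modulo [max_at c] every invariant is a scalar, so an ideal that contains it and one more element
    contains a nonzero scalar, hence 1. *)
Lemma max_at_max c : (hyp_poly K).@[c] = 0 -> is_maximal_ideal (max_at c).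
Proof.
move=> c0; split; first exact: max_at_ideal.
  move=> [p [ep p0]]; have := @zero_meval c p 1 c0.
  by rewrite p0 meval1 rmorph1 => /(_ ep)/esym/eqP; rewrite oner_eq0.
move=> I [I0 ID IM] nI1 mI; apply/seteqP; split=> // z Iz.
have [p ep] := trace_map_surj z; exists p; split=> //.
apply/eqP; apply: contra_notT nI1 => pc.
have Ic : I (p.@[c])%:A.
  rewrite (_ : _%:A = z + (-1) * (trace_map p - (p.@[c])%:A));
    last by rewrite ep; ring.
  by apply: ID => //; apply: IM; apply: mI; exact: max_at_eval.
rewrite -[1](scale1r 1) -(mulVf pc) -scalerA -mulr_algl; exact: IM.
Qed.

End TraceMorphism.

(** * Maximal ideals as points of the hypersurface *)

Section Isomorphism.
Variable R : realType.
Let K : numClosedFieldType := R[i].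
Local Notation f := (hyp_nonconst K).
Local Notation Inv := (invariant_ring K 3).

(** The coordinates are the residues of the nine generators; they satisfy the equation because
    [hyp_poly] maps to 0, which lies in [m]. *)
Lemma residue_point (m : set Inv) : is_maximal_ideal m ->
  exists v : 'rV[K]_9, zeros f v /\ eval_at m (v 0).
Proof.
move=> mm.
have [c cP] : {c : 'I_9 -> K & forall i, m (trace_map (K :=
  K) 'X_i - (c i)%:A)}.
  apply: (@choice _ _ (fun i (a : K) => m (trace_map 'X_i - a%:A))) => i.
  exact: (@maxideal_residue R 9 Inv (@trace_map K) (@trace_map_surj K) m _ mm).
have ec : eval_at m c by apply: eval_at_ind => //; exact: maxideal_ideal.
exists (\row_j c j); have -> : (\row_j c j) 0 = c by apply/funext => j;
  rewrite mxE.
split=> //; rewrite /zeros /= (_ : (\row_j c j) 0 = c);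
  last by apply/funext => j; rewrite mxE.
apply/(eval_atP (hyp_poly K) mm ec).
have -> : trace_map (hyp_poly K) = 0 by apply/trace_map_kernel; exists 1;
  rewrite mul1r.
exact: maxideal0.
Qed.

(** A maximal ideal goes to its residue point. It is recovered from that point by [eval_atP], and
    every point of the hypersurface is reached by its ideal [max_at]. *)
Lemma quotient_hypersurface : isomorphic (SL_pair_quotient K 3) (hypersurface
  f).
Proof.
have [F FP] : {F : @max_ideals K Inv -> zeros f &
    forall x, eval_at (set_val x) (set_val (F x) 0)}.
  apply: (@choice _ _ (fun (x : @max_ideals K Inv) (y : zeros f) =>
    eval_at (set_val x) (set_val y 0))) => x.
  have [v [zv ev]] := residue_point (set_valP x).
  by exists (SigSub (mem_set zv)).
have xmax (x : @max_ideals K Inv) : is_maximal_ideal (set_val x) := set_valP x.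
exists F, (hs_lrmorphism K); split.
- apply: inj_surj_bij => [x y Fxy|y].
    apply: val_inj; apply/seteqP.
    split=> z; have [p <-] := trace_map_surj z.
      move=> /(eval_atP p (xmax x) (FP x)); rewrite Fxy => e.
      exact/(eval_atP p (xmax y) (FP y)).
    move=> /(eval_atP p (xmax y) (FP y)); rewrite -Fxy => e.
    exact/(eval_atP p (xmax x) (FP x)).
  have y0 : (hyp_poly K).@[set_val y 0] = 0 := set_valP y.
  exists (SigSub (mem_set (max_at_max y0))).
  apply: val_inj; apply/rowP => i; set x := SigSub _.
  have /(eval_atP ('X_i - (set_val y 0 i)%:MP) (xmax x) (FP x)) : set_val x
      (trace_map ('X_i - (set_val y 0 i)%:MP)).
    by exists ('X_i - (set_val y 0 i)%:MP); rewrite mevalB mevalXU mevalC subrr.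
  by rewrite mevalB mevalXU mevalC => /eqP; rewrite subr_eq0 => /eqP.
- exact: hs_map_bij.
- move=> x b; have [p ->] := piH_surj b.
  by rewrite /= hs_map_pi (eval_atP p (xmax x) (FP x)) /= hs_evalE.
Qed.

End Isomorphism.

Theorem theorem3p2p2 (R : realType) :
  exists f : nonconst_mpoly R[i] 9,
    [/\ total_degree f = 6%N,
        isomorphic (SL_pair_quotient R[i] 3) (hypersurface f) &
        [set lsubmx (x : 'rV[R[i]]_(8 + 1)) | x in zeros f] =
          [set: 'rV[R[i]]_8]].
Proof.
exists (hyp_nonconst R[i]); split.
- by rewrite /total_degree /= msize_hyp_poly.
- exact: quotient_hypersurface.
apply/seteqP; split=> // v _.
pose p := (commtr_sum_poly R[i]).@[v 0];
  pose q := (commtr_prod_poly R[i]).@[v 0].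
(* Over given traces, the last coordinate is a root of X^2 - p X + q. *)
pose r := sqrtC (p ^+ 2 - 4%:R * q); pose t := (p + r) / 2%:R.
exists (row_mx v t%:M); last by rewrite row_mxKl.
have ew : (row_mx v t%:M) 0 \o widen_ord (leqnSn 8) = v 0.
  apply/funext => i /=.
  by rewrite (_ : widen_ord _ i = lshift 1 i) ?row_mxEl //; apply: val_inj.
have et : (row_mx v t%:M) 0 ord_max = t.
  rewrite (_ : ord_max = rshift 8 (0 : 'I_1)) ?row_mxEr ?mxE ?mulr1n //.
  exact: val_inj.
suff e : (hyp_poly R[i]).@[(row_mx v t%:M) 0] = 0 by exact: e.
rewrite meval_hyp_poly ew et -/p -/q /t.
rewrite (_ : _ - _ + _ = (r ^+ 2 - (p ^+ 2 - 4%:R * q)) / 4%:R).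
  by rewrite sqrtCK subrr mul0r.
by field.
Qed.
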